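(* Let $d\ge2$ be an integer and let $r\in\big(\frac12-\frac1d,\frac12-\frac1{2d}\big)$. Let $(X_i)_{i\in\mathbb Z}$ be the FARIMA$(0,r,0)$ sequence normalised to unit variance, with covariance function $\rho(k)=\mathbb E[X_0X_k]$. Then: (i) $\rho\in\ell^d(\mathbb Z)$; (ii) the Hermite polynomial $f=H_d$ violates the conditional decay condition with respect to $X$, i.e. $$\sum_{\ell>0}\big\|\mathbb E[H_d(X_\ell)\mid\mathcal F_0]\big\|_{L^2(\Omega)}=\infty,\qquad \mathcal F_0=\sigma(X_i:i\le0).$$
   Context: FARIMA$(0,r,0)$ for $r\in(0,\frac12)$: let $(\varepsilon_k)_{k\in\mathbb Z}$ be i.i.d. $\mathcal N(0,1)$ random variables and $c_j=\frac{\Gamma(j+r)}{\Gamma(j+1)\Gamma(r)}$ ($j\ge0$, $\Gamma$ the Gamma function); the (unnormalised) model is $\sum_{j=0}^\infty c_j\varepsilon_{i-j}$, $i\in\mathbb Z$, and the normalised sequence is $X_i=\big(\sum_{j\ge0}c_j^2\big)^{-1/2}\sum_{j=0}^\infty c_j\varepsilon_{i-j}$, so that $\rho(0)=1$. Hermite polynomials: $H_q(x)=(-1)^qe^{x^2/2}\frac{d^q}{dx^q}e^{-x^2/2}$. For a stationary centred Gaussian sequence $X$ with $\rho(0)=1$, a function $f\in L^2(\mathcal N(0,1))$ satisfies the conditional decay condition w.r.t. $X$ if $\sum_{\ell>0}\|\mathbb E[f(X_\ell)\mid\mathcal F_0]\|_{L^2(\Omega)}<\infty$. *)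

(* Defs.v *)
From HB Require Import structures.
From mathcomp Require Import all_boot all_order all_algebra.
From mathcomp Require Import all_classical all_reals all_analysis.
Import Order.TTheory GRing.Theory Num.Theory.
Import numFieldNormedType.Exports.

Set Implicit Arguments.
Unset Strict Implicit.
Unset Printing Implicit Defensive.

Local Open Scope classical_set_scope.
Local Open Scope ring_scope.

(* Euler's integral; only evaluated at x > 0. *)
Definition Gamma {R : realType} (x : R) : R :=
  \int[lebesgue_measure]_(t in `]0, +oo[) (t `^ (x - 1) * expR (- t)).

Definition hermite {R : realType} (q : nat) (x : R) : R :=
  (-1) ^+ q * expR (x ^+ 2 / 2) *
  derive1n q (fun y : R => expR (- (y ^+ 2 / 2))) x.

Definition farima_coef {R : realType} (r : R) (j : nat) : R :=
  Gamma (j%:R + r) / (Gamma (j%:R + 1) * Gamma r).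

Definition farima_var {R : realType} (r : R) : R :=
  limn (series (fun j => farima_coef r j ^+ 2)).

Section Probability.
Context {d : measure_display} {T : measurableType d} {R : realType}.
Variable P : probability T R.

Definition mutually_independent (eps : int -> {RV P >-> R}) : Prop :=
  forall (s : seq int) (B : int -> set R), uniq s ->
    (forall i, measurable (B i)) ->
    P (\bigcap_(i in [set` s]) (eps i @^-1` B i)) =
    (\prod_(i <- s) P (eps i @^-1` B i))%E.

Definition iid_std_normal (eps : int -> {RV P >-> R}) : Prop :=
  mutually_independent eps /\
  forall i (B : set R), measurable B ->
    distribution P (eps i) B = normal_prob 0 1 B.

Definition l2norm (Z : T -> R) : \bar R := ('N[P]_2%:E[EFin \o Z])%E.

(* The infinite moving average is the limit in L^2(P) of its partial sums;
   each X i is thus determined up to a P-null set, and X stands for an arbitrary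
   choice of versions. *)
Definition is_farima (r : R) (eps X : int -> {RV P >-> R}) : Prop :=
  forall i : int,
    l2norm (fun w => X i w - (Num.sqrt (farima_var r))^-1 *
        \sum_(0 <= j < n) farima_coef r j * eps (i - j%:Z) w)
      @[n --> \oo] --> 0%E.

Definition autocov (X : int -> {RV P >-> R}) (k : int) : \bar R :=
  ('E_P[X 0%R \* X k])%E.

Definition past (X : int -> {RV P >-> R}) : set (set T) :=
  <<s \bigcup_(i in [set i : int | i <= 0])
        preimage_set_system setT (X i) measurable >>.

Definition is_cond_exp (G : set (set T)) (Z Y : T -> R) : Prop :=
  [/\ forall B : set R, measurable B -> G (Y @^-1` B),
      P.-integrable setT (EFin \o Y) &
      forall A, G A ->
        (\int[P]_(w in A) (Y w)%:E = \int[P]_(w in A) (Z w)%:E)%E].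

(* A chosen version of E[Z | G]; versions agree P-a.s., so the L^2 norm does not
   depend on the choice. The default value 0 is only taken if there is none. *)
Definition cond_exp (G : set (set T)) (Z : T -> R) : T -> R :=
  xget (cst 0) [set Y | is_cond_exp G Z Y].

Definition cond_decay_sum (f : R -> R) (X : int -> {RV P >-> R}) : \bar R :=
  (\sum_(1 <= l <oo) l2norm (cond_exp (past X) (f \o X l%:Z)))%E.

Definition cond_decay (f : R -> R) (X : int -> {RV P >-> R}) : Prop :=
  (cond_decay_sum f X < +oo)%E.

End Probability.

Definition in_lp {R : realType} (p : nat) (u : int -> \bar R) : Prop :=
  (\esum_(k in [set: int]) (`|u k| ^+ p) < +oo)%E.

(* Main.v *)
(* The recursion (j + 1) c_(j+1) = (j + r) c_j, a form of x Gamma(x) = Gamma(x + 1),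
   gives r j^(r-1) <= c_j <= (j + 1)^(r-1) and |rho(k)| <= C (k + 1) c_k^2, hence
   |rho(k)|^d <= C (k + 1)^(-(1 - 2r)d), which is summable because (1 - 2r)d > 1.

   For (ii) no inversion of the moving average is needed: it suffices to test
   E[H_d(X_l) | F_0] against one variable of the past, U^d with
   U = X_0 + X_(-1) + ... + X_(-l+1).  Linear combinations of the X_i are limits in
   L^2 of Gaussian variables, hence Gaussian, and Stein's identity yields
   E[H_d(X_l) U^d] = d! E[X_l U]^d.  As Var U <= C l^3 c_l^2 and
   E[X_l U] >= c l^2 c_l^2, the Cauchy-Schwarz inequality bounds the L^2 norm of the
   conditional expectation from below by a multiple of (l^(1/2) c_l)^d, hence of
   l^(-(1 - 2r)d/2), hence of 1/l because (1 - 2r)d < 2. *)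
Require Import Defs.
From HB Require Import structures.
From mathcomp Require Import all_boot all_order all_algebra.
From mathcomp Require Import all_classical all_reals all_analysis.
From mathcomp Require Import measurable_realfun.
From mathcomp Require Import ring lra.
Import Order.TTheory GRing.Theory Num.Theory.
Import numFieldNormedType.Exports.

Set Implicit Arguments.
Unset Strict Implicit.
Unset Printing Implicit Defensive.

Local Open Scope classical_set_scope.
Local Open Scope ring_scope.

(** * Growth of the coefficients *)

(** Gaussianity enters only through moments: a variable counts as Gaussian when its moments are
    those of a centred normal law of the same variance. Moments do not pass to mean-square limits in
    general; here they do because bounded variances bound all Gaussian moments. The joint law of
    $(X_l,U)$ is never described: it suffices that $sX_l+U$ is Gaussian for every real $s$, because
    the moments of $sX_l+U$ are polynomials in $s$ whose coefficients carry the mixed moments. The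
    block $U$ has length $l$ so that all its lags to $X_l$ lie between $l$ and $2l$, where the
    coefficients are comparable to $c_l$. The quotient $E[X_lU]^2/\mathrm{Var}\,U$ is then of order
    $lc_l^2$, which is the order of $\sum_{j\ge l}c_j^2$, up to normalisation the variance of the
    part of $X_l$ carried by the noise up to time $0$. Testing against this single variable
    therefore loses nothing in order of magnitude. *)

Section farima_sequence.
Context {R : realType} (r : R) (c : nat -> R).
Hypothesis r01 : 0 < r < 1 / 2.
Hypothesis c0 : c 0%N = 1.
Hypothesis cS : forall n, c n.+1 * n.+1%:R = c n * (n%:R + r).

Lemma coef_gt0 n : 0 < c n.
Proof.
elim: n => [|n IH]; first by rewrite c0.
have h : 0 < c n.+1 * n.+1%:R.
  by rewrite cS mulr_gt0// ltr_wpDl//; case/andP: r01.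
by rewrite -(pmulr_lgt0 _ (ltr0Sn R n)).
Qed.

Lemma coef_leS n : c n.+1 <= c n.
Proof.
have /andP[rp r2] := r01.
rewrite -(@ler_pM2r _ n.+1%:R)// cS ler_pM2l ?coef_gt0// -natr1.
by rewrite lerD2l; lra.
Qed.

Lemma coef_le m n : (m <= n)%N -> c n <= c m.
Proof.
move=> /subnK <-; elim: (n - m)%N => // k IH.
by rewrite addSn (le_trans (coef_leS _)).
Qed.

(** The recursion reads $(n+1)c_{n+1}-nc_n=rc_n$, so the sum telescopes. This exact formula replaces
    asymptotics in the estimates of convolutions. *)
Lemma coef_sum n : \sum_(j < n) c j = n%:R * c n / r.
Proof.
have r0 : r != 0 by rewrite gt_eqF//; case/andP: r01.
elim: n => [|n IH]; first by rewrite big_ord0 !mul0r.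
rewrite big_ord_recr/= IH.
apply: (mulIf r0); rewrite mulrDl !divfK// [RHS]mulrC cS; ring.
Qed.

(** Since [n * c n] is $r$ times a partial sum of positive terms, it is nondecreasing. With [m = 2]
    this is the doubling bound that complements the monotonicity of [c]. *)
Lemma coef_mul_le m n : (0 < n)%N -> (0 < m)%N -> c n <= m%:R * c (m * n)%N.
Proof.
move=> n0 m0.
have h : \sum_(j < n) c j <= \sum_(j < m * n) c j.
  rewrite -(big_mkord xpredT) -(big_mkord xpredT c).
  rewrite (@big_cat_nat _ _ _ n _ (m * n))//= ?leq_pmull//.
  by rewrite lerDl sumr_ge0// => i _; exact/ltW/coef_gt0.
have rp : 0 < r by case/andP: r01.
rewrite !coef_sum ler_pM2r ?invr_gt0// natrM in h.
by rewrite -(@ler_pM2l _ n%:R) ?ltr0n// mulrCA mulrA.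
Qed.

(** The sequence $(n+1)c_n^2$ behaves like $n^{2r-1}$, and its decrements dominate $c_n^2$. Clearing
    denominators leaves a polynomial inequality with slack $(1-r^2)n+2r(1-r)$. *)
Lemma coef_sqr_telescope n :
  (1 - 2 * r) * c n ^+ 2 <= n.+1%:R * c n ^+ 2 - n.+2%:R * c n.+1 ^+ 2.
Proof.
have /andP[rp r2] := r01.
have n0 : 0 < n.+1%:R :> R by [].
have -> : c n.+1 = c n * (n%:R + r) / n.+1%:R by rewrite -cS mulfK// gt_eqF.
have h : (1 - 2 * r) * n.+1%:R ^+ 2 <=
    n.+1%:R ^+ 3 - n.+2%:R * (n%:R + r) ^+ 2.
  have -> : n.+1%:R = n%:R + 1 :> R by rewrite -natr1.
  have -> : n.+2%:R = n%:R + 2 :> R by rewrite -addn2 natrD.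
  have : 0 <= n%:R :> R by [].
  move: (n%:R : R) => x x0; rewrite -subr_ge0.
  have -> : (x + 1) ^+ 3 - (x + 2) * (x + r) ^+ 2 - (1 - 2 * r) * (x + 1) ^+ 2 =
    (1 - r) * (1 + r) * x + 2 * r * (1 - r) by ring.
  by rewrite addr_ge0 ?mulr_ge0//; lra.
rewrite -(@ler_pM2r _ (n.+1%:R ^+ 2)) ?exprn_gt0//.
have -> : (n.+1%:R * c n ^+ 2 - n.+2%:R * (c n * (n%:R + r) / n.+1%:R) ^+ 2) * n.+1%:R ^+ 2
   = c n ^+ 2 * (n.+1%:R ^+ 3 - n.+2%:R * (n%:R + r) ^+ 2).
  by field; rewrite addrC natr1 gt_eqF.
by rewrite mulrAC mulrC ler_pM2l ?exprn_gt0 ?coef_gt0.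
Qed.

Lemma coef_sqr_tail k n :
  \sum_(k <= j < n) c j ^+ 2 <= k.+1%:R * c k ^+ 2 / (1 - 2 * r).
Proof.
have /andP[rp r2] := r01.
have r2' : 0 < 1 - 2 * r by lra.
have [kn|nk] := leqP k n; last first.
  rewrite big_geq; last exact: ltnW.
  by rewrite divr_ge0 ?ltW// mulr_gt0 ?exprn_gt0 ?coef_gt0.
rewrite ler_pdivlMr// mulrC mulr_sumr.
apply: (@le_trans _ _ (\sum_(k <= j < n) (j.+1%:R * c j ^+ 2 - j.+2%:R * c j.+1 ^+ 2))).
  by apply: ler_sum => j _; exact: coef_sqr_telescope.
rewrite -[X in X <= _]opprK -sumrN.
under eq_bigr do rewrite opprB.
rewrite (telescope_sumr (fun j => j.+1%:R * c j ^+ 2))// opprB.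
by rewrite lerBlDr lerDl mulr_ge0// sqr_ge0.
Qed.

(** The range is cut at $j=k$: below, $c_{j+k}\le c_k$ and the sum of the $c_j$ is explicit; above,
    $c_{j+k}\le c_j$ and the tail of squares applies. *)
Lemma coef_conv_tail k n : \sum_(j < n) c j * c (j + k)%N <=
  (k%:R / r + k.+1%:R / (1 - 2 * r)) * c k ^+ 2.
Proof.
have /andP[rp r2] := r01.
have cge j : 0 <= c j by exact/ltW/coef_gt0.
(* Extending the range to [maxn k n] lets it be cut at [k] even when [n < k]. *)
apply: (@le_trans _ _ (\sum_(0 <= j < maxn k n) c j * c (j + k)%N)).
  rewrite -(big_mkord xpredT (fun j => c j * c (j + k)%N)).
  rewrite [leRHS](@big_cat_nat _ _ _ n)//= ?leq_maxr//.
  by rewrite lerDl sumr_ge0// => i _; rewrite mulr_ge0.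
rewrite (@big_cat_nat _ _ _ k)//= ?leq_maxl// mulrDl lerD//.
  apply: (@le_trans _ _ (\sum_(0 <= j < k) c j * c k)).
    by apply: ler_sum => j _; rewrite ler_wpM2l// coef_le// leq_addl.
  rewrite -mulr_suml big_mkord coef_sum expr2.
  by rewrite le_eqVlt; apply/orP; left; apply/eqP; ring.
apply: (le_trans _ (le_trans (coef_sqr_tail k (maxn k n)) _)).
  by apply: ler_sum => j _; rewrite expr2 ler_wpM2l// coef_le// leq_addr.
by rewrite le_eqVlt; apply/orP; left; apply/eqP; ring.
Qed.

(** The first $k$ terms are enough: there $c_{j+k}\ge c_{2k}\ge c_k/2$, and the other factor sums to
    $kc_k/r$. *)
Lemma coef_conv_ge k n : (0 < k <= n)%N ->
  k%:R * c k ^+ 2 / (2 * r) <= \sum_(j < n) c j * c (j + k)%N.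
Proof.
move=> /andP[k0 kn]; have /andP[rp r2] := r01.
have cge j : 0 <= c j by exact/ltW/coef_gt0.
apply: (@le_trans _ _ (\sum_(j < k) c j * c (2 * k)%N)).
  rewrite -mulr_suml coef_sum.
  have := coef_mul_le k0 (ltn0Sn 1%N); have := cge k.
  set a := c k; set b := c (2 * k)%N => a0 ab.
  have -> : k%:R * a ^+ 2 / (2 * r) = (k%:R * a / r) * (a / 2).
    by field; rewrite gt_eqF.
  rewrite ler_wpM2l ?mulr_ge0 ?invr_ge0 ?(ltW rp)//.
  by rewrite ler_pdivrMr// mulrC.
rewrite -(big_mkord xpredT (fun j => c j * c (2 * k)%N)).
rewrite -(big_mkord xpredT (fun j => c j * c (j + k)%N)).
rewrite (@big_cat_nat _ _ _ k _ n)//=.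
rewrite -[leLHS]addr0 lerD//; last by rewrite sumr_ge0// => i _; rewrite mulr_ge0.
rewrite big_nat [leRHS]big_nat; apply: ler_sum => j /andP[_ jk].
by rewrite ler_wpM2l// coef_le// mul2n -addnn leq_add2r ltnW.
Qed.

(** From $r(k+1)\le k+r$ one gets $r(k+1)c_k\le(k+1)c_{k+1}\le nc_n$, the last step because $mc_m$
    is nondecreasing; the remaining factor $c_k$ sums in closed form. *)
Lemma coef_weighted_sum n :
  \sum_(k < n) k.+1%:R * c k ^+ 2 <= (n%:R * c n) ^+ 2 / r ^+ 2.
Proof.
have /andP[rp r2] := r01.
have cge j : 0 <= c j by exact/ltW/coef_gt0.
have nd m : (m <= n)%N -> m%:R * c m <= n%:R * c n.
  move=> mn; have := coef_sum m; have := coef_sum n.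
  rewrite -(big_mkord xpredT) -(big_mkord xpredT c).
  rewrite (@big_cat_nat _ _ _ m _ n)//= => h1 h2.
  rewrite -(@ler_pM2r _ r^-1) ?invr_gt0// -h1 -h2 lerDl sumr_ge0//.
apply: (@le_trans _ _ (\sum_(k < n) n%:R * c n / r * c k)).
  apply: ler_sum => k _; rewrite expr2 mulrA ler_wpM2r//.
  rewrite ler_pdivlMr//.
  apply: le_trans (nd _ (ltn_ord k)).
  rewrite [leRHS]mulrC cS [leRHS]mulrC -natr1.
  rewrite [leLHS]mulrAC ler_wpM2r//.
  have : 0 <= k%:R :> R by [].
  nra.
rewrite -mulr_sumr coef_sum le_eqVlt; apply/orP; left; apply/eqP.
by field; rewrite gt_eqF.
Qed.

(** The ratio $c_{n+1}/c_n=1-(1-r)/(n+1)$ is at most $e^{-(1-r)/(n+1)}$, and $\ln(1+y)\le y$ at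
    $y=1/(n+1)$ bounds this by $((n+2)/(n+1))^{r-1}$. *)
Lemma coef_powR_ub n : c n <= (n%:R + 1) `^ (r - 1).
Proof.
have /andP[rp r2] := r01.
elim: n => [|n IH]; first by rewrite c0 add0r powR1.
rewrite -(@ler_pM2r _ n.+1%:R) ?ltr0n// cS.
have n0 : 0 <= n%:R :> R by [].
apply: (le_trans (ler_wpM2r _ IH)); first by lra.
rewrite -natr1; move: n0; move: (n%:R : R) => x x0.
have x1 : 0 < x + 1 by lra.
have x2 : 0 < x + 1 + 1 by lra.
have -> : x + 1 + 1 = (x + 1) * (1 + (x + 1)^-1) by field; rewrite gt_eqF.
have y0 : 0 < (x + 1)^-1 by rewrite invr_gt0.
rewrite powRM; [|lra|by lra].
rewrite -mulrA ler_wpM2l ?powR_ge0//.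
rewrite /powR gt_eqF ?ltr_wpDl//.
have h : (r - 1) / (x + 1) <= (r - 1) * ln (1 + (x + 1)^-1).
  have : 0 <= (1 - r) * ((x + 1)^-1 - ln (1 + (x + 1)^-1)).
    by rewrite mulr_ge0 ?subr_ge0 ?le_ln1Dx//; lra.
  by set l := ln (1 + _); lra.
have h2 := le_trans (expR_ge1Dx ((r - 1) / (x + 1)))
  (_ : _ <= expR ((r - 1) * ln (1 + (x + 1)^-1))).
have {h2} := h2 _; rewrite ler_expR => /(_ h) h2.
apply: (le_trans _ (ler_wpM2r (ltW x1) h2)).
rewrite mulrDl mul1r divfK ?gt_eqF//.
by lra.
Qed.

(** Young's inequality for $y^a$ and $1$ with conjugate exponents $1/a$ and $1/(1-a)$. *)
Lemma powR_bernoulli (y a : R) : 0 <= y -> 0 < a < 1 -> y `^ a <= a * y + (1 - a).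
Proof.
move=> y0 /andP[a0 a1].
have := @conjugate_powR R (y `^ a) 1 (a^-1) ((1 - a)^-1).
rewrite mulr1 powR1 -powRrM mulfV ?gt_eqF// powRr1// !invrK.
rewrite mul1r mulrC; apply.
- exact: powR_ge0.
- by [].
- by rewrite invr_gt0.
- by rewrite invr_gt0 subr_gt0.
- by rewrite addrC subrK.
Qed.

(** The induction starts at $c_1=r$, which fixes the constant. Its step is Bernoulli's inequality
    for $n/(n+1)$ with exponent $1-r$, whose right-hand side is exactly the ratio $(n+r)/(n+1)$. *)
Lemma coef_powR_lb n : (0 < n)%N -> r * n%:R `^ (r - 1) <= c n.
Proof.
have /andP[rp r2] := r01.
case: n => // n _; elim: n => [|n IH].
  have := cS 0; rewrite c0 mulr1 mul1r add0r => ->.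
  by rewrite powR1 mulr1.
have n0 : 0 <= n%:R :> R by [].
rewrite -(@ler_pM2r _ n.+2%:R) ?ltr0n// cS.
have n1 : 0 < n.+1%:R :> R by [].
have n2 : 0 < n.+2%:R :> R by [].
apply: le_trans (_ : r * n.+1%:R `^ (r - 1) * (n.+1%:R + r) <= _); last first.
  by rewrite ler_wpM2r//; lra.
rewrite -!mulrA ler_pM2l//.
have b : (n.+1%:R / n.+2%:R) `^ (1 - r) <= (n.+1%:R + r) / n.+2%:R.
  apply: (le_trans (powR_bernoulli _ _)).
  - by rewrite divr_ge0.
  - by apply/andP; split; lra.
  rewrite -(@ler_pM2r _ n.+2%:R)// mulrDl mulrA !divfK ?gt_eqF//.
  have : n.+2%:R = n.+1%:R + 1 :> R by rewrite -natr1.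
  by move=> ->; lra.
rewrite -ler_pdivlMr//.
have -> : n.+2%:R `^ (r - 1) = n.+1%:R `^ (r - 1) * (n.+1%:R / n.+2%:R) `^ (1 - r).
  rewrite powRM ?invr_ge0// mulrA -powRD; last by rewrite (gt_eqF n1) implybT.
  have -> : r - 1 + (1 - r) = 0 by lra.
  rewrite powRr0 mul1r -(powR_inv1 (ltW n2)) -powRrM.
  by congr (_ `^ _); lra.
by rewrite -mulrA ler_wpM2l ?powR_ge0.
Qed.

End farima_sequence.

(** * Sums of negative powers *)

Section powR_series.
Context {R : realType}.

(** A discrete form of $-(x^{-a})'=ax^{-a-1}$: factor out $(x+1)^{-a}$, then use $e^u\ge1+u$ and
    $\ln(1-v)\le-v$ at $v=1/(x+1)$. *)
Lemma powR_telescope (a x : R) : 0 < a -> 1 <= x ->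
  a * (x + 1) `^ (- a - 1) <= x `^ (- a) - (x + 1) `^ (- a).
Proof.
move=> a0 x1; have x0 : 0 < x by lra.
have x10 : 0 < x + 1 by lra.
have -> : x `^ (- a) = (x + 1) `^ (- a) * (x / (x + 1)) `^ (- a).
  by rewrite -powRM ?divr_ge0 ?ltW// mulrC divfK// gt_eqF.
have -> : (x + 1) `^ (- a - 1) = (x + 1) `^ (- a) * (x + 1)^-1.
  rewrite powRD; last by rewrite (gt_eqF x10) implybT.
  by rewrite powR_inv1// ltW.
rewrite -[X in _ <= _ - X]mulr1 -mulrBr mulrCA ler_wpM2l ?powR_ge0//.
rewrite lerBrDr addrC.
rewrite [X in _ <= X]/powR gt_eqF ?divr_gt0//.
apply: (@le_trans _ _ (1 + - a * ln (x / (x + 1)))); last exact: expR_ge1Dx.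
rewrite lerD2l mulNr -mulrN ler_pM2l//.
have -> : x / (x + 1) = 1 + (- (x + 1)^-1) by field; rewrite gt_eqF.
rewrite lerNr; apply: le_ln1Dx.
by rewrite ltrN2 invf_lt1//; lra.
Qed.

Lemma sum_powR_le (a : R) n : 0 < a ->
  \sum_(k < n) (k%:R + 1) `^ (- a - 1) <= 1 + a^-1.
Proof.
move=> a0; case: n => [|n]; first by rewrite big_ord0 addr_ge0// invr_ge0 ltW.
rewrite big_ord_recl/= add0r powR1 lerD2l -(ler_pM2l a0) mulfV ?gt_eqF// mulr_sumr.
apply: (@le_trans _ _ (\sum_(0 <= k < n) ((k.+1%:R) `^ (- a) - k.+2%:R `^ (- a)))).
  rewrite big_mkord; apply: ler_sum => k _.
  rewrite -[k.+2%:R]natr1 /bump/= add1n; apply: powR_telescope => //.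
  by rewrite ler1n.
rewrite -[leLHS]opprK -sumrN; under eq_bigr do rewrite opprB.
rewrite (telescope_sumr (fun k => k.+1%:R `^ (- a)))// opprB powR1.
by rewrite lerBlDr lerDl powR_ge0.
Qed.

End powR_series.

(** * The Gamma function *)

Section exhaustion.
Context {R : realType}.
Notation mu := (@lebesgue_measure R).

(* Integrating [F' = u - v] over compact intervals exhausting [D]: since [u] and
   [v] are nonnegative, no integrability is needed. *)
Lemma ge0_FTC2_exhaust (F u v : R -> R) (a b : nat -> R) (D : set R) (L : R) :
  (forall n, a n < b n) ->
  nonincreasing_seq a -> nondecreasing_seq b ->
  \bigcup_n `[a n, b n]%classic = D ->
  (forall x, D x -> 0 <= u x) -> (forall x, D x -> 0 <= v x) ->
  (forall x, D x -> {for x, continuous u}) ->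
  (forall x, D x -> {for x, continuous v}) ->
  (forall x, D x -> is_derive x 1 F (u x - v x)) ->
  F (b n) - F (a n) @[n --> \oo] --> L ->
  (\int[mu]_(x in D) (u x)%:E = L%:E + \int[mu]_(x in D) (v x)%:E)%E.
Proof.
move=> ab ina ndb DE u0 v0 cu cv dF FL.
have sub n : `[a n, b n] `<=` D by rewrite -DE => x xn; exists n.
have nd : nondecreasing_seq (fun n => `[a n, b n]%classic).
  move=> m n mn; apply/subsetPset => x/=; rewrite !in_itv/= => /andP[h1 h2].
  by rewrite (le_trans (ina _ _ mn))// (le_trans h2)// ndb.
have wc (w : R -> R) n : (forall x, D x -> {for x, continuous w}) ->
    {within `[a n, b n], continuous w}.
  move=> cw; apply: continuous_in_subspaceT => x /set_mem xab.
  exact/cw/sub/xab.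
have mw (w : R -> R) n : (forall x, D x -> {for x, continuous w}) ->
    measurable_fun `[a n, b n] (EFin \o w).
  move=> cw; apply/measurable_EFinP; apply: subspace_continuous_measurable_fun => //.
  exact: wc.
have iw (w : R -> R) n : (forall x, D x -> {for x, continuous w}) ->
    mu.-integrable `[a n, b n] (EFin \o w).
  move=> cw; apply: continuous_compact_integrable; first exact: segment_compact.
  exact: wc.
have cF x : D x -> {for x, continuous F}.
  by move=> /dF h; apply/differentiable_continuous/derivable1_diffP.
have lim (w : R -> R) : (forall x, D x -> {for x, continuous w}) -> (forall x, D x -> 0 <= w x) ->
    (\int[mu]_(x in `[a n, b n]) (w x)%:E @[n --> \oo] -->
     \int[mu]_(x in D) (w x)%:E)%E.
  move=> cw w0; rewrite -DE; apply: ge0_nondecreasing_set_cvg_integral => //.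
  - by move=> n; exact: mw.
  - by move=> n x /sub Dx; rewrite lee_fin w0.
have eqn n : (\int[mu]_(x in `[a n, b n]) (u x)%:E =
    (F (b n) - F (a n))%:E + \int[mu]_(x in `[a n, b n]) (v x)%:E)%E.
  have := @continuous_FTC2 R (fun x => u x - v x) F (a n) (b n) (ab n).
  rewrite -EFinB => <-.
  - under [X in (X + _)%E]eq_integral do rewrite EFinB.
    rewrite (integralB_EFin _ (iw u n cu) (iw v n cv))// subeK//.
    exact: integrable_fin_num (iw v n cv).
  - apply: wc => x Dx; apply: (@cvgB _ R^o); [exact: cu|exact: cv].
  - split.
    + by move=> x /subset_itv_oo_cc/sub/dF h; exact: ex_derive.
    + apply: cvg_at_right_filter; apply/cF/(sub n) => /=.
      by rewrite in_itv/= lexx ltW.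
    + apply: cvg_at_left_filter; apply/cF/(sub n) => /=.
      by rewrite in_itv/= lexx ltW.
  - move=> x /subset_itv_oo_cc/sub/dF h; rewrite derive1E.
    exact: derive_val.
have h1 := lim u cu u0.
have h2 : ((F (b n) - F (a n))%:E + \int[mu]_(x in `[a n, b n]) (v x)%:E @[n --> \oo] -->
    L%:E + \int[mu]_(x in D) (v x)%:E)%E.
  apply: cvgeD; last exact: lim.
  - by rewrite fin_num_adde_defr.
  - by apply/cvg_EFin => //; exact: nearW.
move: h2; under eq_cvg do rewrite -eqn; move=> h2.
exact: (cvg_unique _ h1 h2).
Qed.

Lemma is_derive_expRN (x : R) :
  is_derive x 1 (fun t : R => expR (- t)) (- expR (- x)).
Proof. by apply: is_derive_eq; rewrite mulrN1. Qed.

(** The exponential beats its Taylor term of degree $m+1$ with $m\ge x$, which leaves a bound of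
    order $1/n$. The argument [n.+2] is the right endpoint of the exhausting intervals used for the
    Gamma and the normal integrals. *)
Lemma cvgn_powR_expRN (x : R) :
  n.+2%:R `^ x * expR (- n.+2%:R) @[n --> \oo] --> 0.
Proof.
pose m := (Num.truncn `|x|).+1.
have xm : x <= m%:R by rewrite (le_trans (ler_norm _))// ltW// truncnS_gt.
apply: (@squeeze_cvgr _ _ _ _ (fun=> 0) (fun n => (m.+1)`!%:R * n.+1%:R^-1)).
- apply: nearW => n; rewrite mulr_ge0 ?powR_ge0 ?expR_ge0//=.
  have n0 : 0 < n.+2%:R :> R by [].
  have h := expR_ge1Dxn m (ltW n0).
  have h1 : n.+2%:R ^+ m.+1 / (m.+1)`!%:R <= expR n.+2%:R :> R.
    by apply: le_trans h; rewrite lerDr.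
  rewrite expRN ler_pdivrMr ?expR_gt0//.
  apply: (@le_trans _ _ (n.+2%:R ^+ m)).
    by rewrite -powR_mulrn// ler_powR// ler1n.
  rewrite -mulrA mulrCA -ler_pdivrMl ?invr_gt0// invrK.
  apply: (@le_trans _ _ ((m.+1)`!%:R * (n.+2%:R ^+ m.+1 / (m.+1)`!%:R))).
    rewrite mulrCA mulfV ?mulr1; last by rewrite pnatr_eq0 -lt0n fact_gt0.
    by rewrite exprS ler_wpM2r ?exprn_ge0// ler_nat.
  by rewrite ler_wpM2l.
- exact: cvg_cst.
- rewrite -[X in _ --> X](mulr0 ((m.+1)`!%:R)).
  by apply: cvgMr; exact: cvg_harmonic.
Qed.

End exhaustion.

Section Gamma_function.
Context {R : realType}.
Implicit Types x : R.
Notation mu := (@lebesgue_measure R).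

(** Valued in the extended reals, because the functional equation is proved first and finiteness is
    deduced from it. *)
Definition Gamma_int x : \bar R :=
  (\int[mu]_(t in `]0%R, +oo[) (t `^ (x - 1) * expR (- t))%:E)%E.

Let D : set R := `]0, +oo[%classic.
(** The shift by two makes [a n < 1 < b n] already at [n = 0]. *)
Let a n : R := n.+2%:R^-1.
Let b n : R := n.+2%:R.

Let ab n : a n < b n.
Proof.
by rewrite /a /b (@lt_trans _ _ 1)// ?invf_lt1// ?ltr1n.
Qed.

Let ina : nonincreasing_seq a.
Proof.
by move=> m n mn; rewrite /a lef_pV2 ?posrE// ler_nat !ltnS.
Qed.

Let ndb : nondecreasing_seq b.
Proof. by move=> m n mn; rewrite /b ler_nat !ltnS. Qed.

Let abD : \bigcup_n `[a n, b n]%classic = D.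
Proof.
apply/seteqP; split=> x/=.
  move=> [n _] /=; rewrite /D/= !in_itv/= andbT => /andP[+ _].
  by apply: lt_le_trans; rewrite /a.
rewrite /D/= in_itv/= andbT => x0.
pose n := Num.truncn (Num.max x x^-1).
have h : Num.max x x^-1 < n.+1%:R by rewrite truncnS_gt.
have h2 : Num.max x x^-1 <= n.+2%:R by rewrite (le_trans (ltW h))// ler_nat.
move: h2; rewrite ge_max => /andP[h3 h4].
exists n => //=; rewrite in_itv/= /b h3 andbT /a.
by rewrite -[leRHS]invrK lef_pV2 ?posrE ?invr_gt0.
Qed.

Let cva : a n @[n --> \oo] --> (0 : R).
Proof.
have := @cvg_harmonic R; rewrite -(cvg_shiftn 1)/=.
by under eq_cvg do rewrite addn1.
Qed.

Let cexpN (t : R) : {for t, continuous (fun t : R => expR (- t))}.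
Proof. by apply: continuous_comp; [exact: opp_continuous|exact: continuous_expR]. Qed.

Let cpow x (t : R) : D t -> {for t, continuous (fun t : R => t `^ x)}.
Proof.
rewrite /D/= in_itv/= andbT => t0.
apply/differentiable_continuous/derivable1_diffP.
by apply: derivable_powR; rewrite in_itv/= t0.
Qed.

Let cpowexp x (t : R) : D t -> {for t, continuous (fun t : R => t `^ x * expR (- t))}.
Proof. by move=> Dt; apply: cvgM; [exact: cpow|exact: cexpN]. Qed.

Lemma measurable_Gamma_integrand x :
  measurable_fun D (fun t : R => (t `^ x * expR (- t))%:E).
Proof.
apply/measurable_EFinP/measurable_funTS/measurable_funM => //=.
by apply: measurableT_comp => //; exact: measurableT_comp.
Qed.

Lemma Gamma_int_ge0 x : (0 <= Gamma_int x)%E.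
Proof. by apply: integral_ge0 => t _; rewrite lee_fin mulr_ge0 ?powR_ge0 ?expR_ge0. Qed.

Lemma Gamma_int1 : Gamma_int 1 = 1%E.
Proof.
rewrite /Gamma_int; under eq_integral do rewrite subrr powRr0 mul1r.
transitivity (1%:E + \int[mu]_(x in D) (cst 0 x)%:E)%E; last first.
  by rewrite integral0 adde0.
apply: (@ge0_FTC2_exhaust _ (fun t => - expR (- t)) _ _ a b _ 1 ab ina ndb abD) => //.
- by move=> x Dx; exact: cst_continuous.
- move=> x Dx; rewrite subr0.
  have h := is_derive_expRN x.
  by apply: is_derive_eq; rewrite opprK.
- have -> : (1 : R) = - 0 + expR (- 0) by rewrite oppr0 expR0 add0r.
  apply: cvgD.
    apply: cvgN; have := @cvgn_powR_expRN R 0.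
    by under eq_cvg do rewrite powRr0 mul1r.
  under eq_cvg do rewrite opprK.
  apply: (continuous_cvg _ (@cexpN 0)).
  exact: cva.
Qed.

(** Integration by parts: the boundary function $t^xe^{-t}$ vanishes at both ends, at $0$ because
    $x>0$. *)
Lemma Gamma_intS x : 0 < x -> (x%:E * Gamma_int x)%E = Gamma_int (x + 1).
Proof.
move=> x0; rewrite /Gamma_int -ge0_integralZl//; last 3 first.
- exact: measurable_Gamma_integrand.
- by move=> t _; rewrite lee_fin mulr_ge0 ?powR_ge0 ?expR_ge0.
- by rewrite lee_fin ltW.
under eq_integral do rewrite -EFinM.
under [RHS]eq_integral do rewrite addrK.
rewrite -[RHS]add0e.
apply: (@ge0_FTC2_exhaust _ (fun t => t `^ x * expR (- t)) _ _ a b _ 0 ab ina ndb abD) => //.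
- by move=> t _; rewrite mulr_ge0 ?mulr_ge0 ?powR_ge0 ?expR_ge0// ltW.
- by move=> t _; rewrite mulr_ge0 ?powR_ge0 ?expR_ge0.
- by move=> t Dt; apply: cvgMr; exact: cpowexp.
- by move=> t Dt; exact: cpowexp.
- move=> t; rewrite /D/= in_itv/= andbT => t0.
  have h := is_derive1_powR x t0.
  have h1 := is_derive_expRN t.
  by apply: is_derive_eq; rewrite /GRing.scale/=; ring.
- rewrite -[X in _ --> X](subrr (0 : R)); apply: cvgB; first exact: cvgn_powR_expRN.
  apply: (@squeeze_cvgr _ _ _ _ (fun=> 0) (fun n => a n `^ x)).
  + apply: nearW => n; rewrite mulr_ge0 ?powR_ge0 ?expR_ge0//=.
    by rewrite ler_piMr ?powR_ge0// expR_le1 oppr_le0 /a.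
  + exact: cvg_cst.
  + apply: ((cvg_at_rightP _ _ _).1 (powR_cvg0 x0)); split; last exact: cva.
    by move=> n; rewrite /a invr_gt0.
Qed.

Let Gamma_int_natS_lty n : (Gamma_int n.+1%:R < +oo)%E.
Proof.
elim: n => [|n IH]; first by rewrite Gamma_int1 ltry.
by rewrite -[n.+2%:R]natr1 -Gamma_intS// lte_mul_pinfty.
Qed.

(** The functional equation trades [x] for [x + 1], which removes the singularity at $0$; then
    $t^x\le1+t^m$ for an integer $m\ge x$, and the integer values are finite by recursion. *)
Lemma Gamma_int_lty x : 0 < x -> (Gamma_int x < +oo)%E.
Proof.
move=> x0; have : (Gamma_int (x + 1) < +oo)%E; last first.
  rewrite -Gamma_intS//; have := Gamma_int_ge0 x.
  by case: (Gamma_int x) => [y| |]//=; rewrite ?ltry// gt0_muley ?lte_fin.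
pose m := (Num.truncn x).+1.
have xm : x <= m%:R by rewrite ltW// truncnS_gt.
apply: (@le_lt_trans _ _ (Gamma_int 1 + Gamma_int (m.+1)%:R)%E); last first.
  by rewrite lte_add_pinfty// Gamma_int1 ltry.
rewrite /Gamma_int -ge0_integralD//; last 4 first.
- by move=> t _; rewrite lee_fin mulr_ge0 ?powR_ge0 ?expR_ge0.
- exact: measurable_Gamma_integrand.
- by move=> t _; rewrite lee_fin mulr_ge0 ?powR_ge0 ?expR_ge0.
- exact: measurable_Gamma_integrand.
apply: ge0_le_integral => //.
- by move=> t _; rewrite lee_fin mulr_ge0 ?powR_ge0 ?expR_ge0.
- exact: measurable_Gamma_integrand.
- by apply: emeasurable_funD; exact: measurable_Gamma_integrand.
move=> t; rewrite /= in_itv/= andbT => t0; rewrite -EFinD lee_fin -mulrDl.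
rewrite ler_wpM2r ?expR_ge0// subrr powRr0 addrK -natr1 addrK.
have [t1|t1] := leP t 1.
  rewrite (@le_trans _ _ 1)//; last by rewrite lerDl powR_ge0.
  rewrite -(powRr0 t); apply: ger_powR; last exact: ltW.
  by rewrite t0.
rewrite (@le_trans _ _ (t `^ m%:R))//; last by rewrite lerDr.
by apply: ler_powR => //; exact: ltW.
Qed.

Lemma GammaE x : Gamma x = fine (Gamma_int x).
Proof. by []. Qed.

Lemma GammaS x : 0 < x -> Gamma (x + 1) = x * Gamma x.
Proof.
move=> x0; rewrite !GammaE -Gamma_intS// fineM//.
by rewrite ge0_fin_numE ?Gamma_int_lty ?Gamma_int_ge0.
Qed.

Lemma Gamma1 : Gamma (1 : R) = 1.
Proof. by rewrite GammaE Gamma_int1. Qed.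

(** Division by zero returns zero, so [farima_coef r 0 = 1] depends on this. For $0<x<1$ one has
    $t^{x-1}+t^x\ge1$, hence $\Gamma(x)+\Gamma(x+1)\ge1$, whereas $\Gamma(x)=0$ would make both
    terms vanish. *)
Lemma Gamma_neq0 x : 0 < x < 1 -> Gamma x != 0.
Proof.
move=> /andP[x0 x1]; apply/eqP => G0.
have h : (1 <= Gamma_int x + Gamma_int (x + 1))%E.
  rewrite -Gamma_int1 /Gamma_int -ge0_integralD//; last 4 first.
  - by move=> t _; rewrite lee_fin mulr_ge0 ?powR_ge0 ?expR_ge0.
  - exact: measurable_Gamma_integrand.
  - by move=> t _; rewrite lee_fin mulr_ge0 ?powR_ge0 ?expR_ge0.
  - exact: measurable_Gamma_integrand.
  apply: ge0_le_integral => //.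
  - by move=> t _; rewrite lee_fin mulr_ge0 ?powR_ge0 ?expR_ge0.
  - exact: measurable_Gamma_integrand.
  - by apply: emeasurable_funD; exact: measurable_Gamma_integrand.
  move=> t; rewrite /= in_itv/= andbT => t0; rewrite -EFinD lee_fin -mulrDl.
  rewrite ler_wpM2r ?expR_ge0// subrr powRr0 addrK.
  have [t1|t1] := leP t 1.
    rewrite (@le_trans _ _ (t `^ (x - 1)))//; last by rewrite lerDl powR_ge0.
    rewrite -[leLHS](powRr0 t); apply: ger_powR; first by rewrite t0.
    by lra.
  rewrite (@le_trans _ _ (t `^ x))//; last by rewrite lerDr powR_ge0.
  by rewrite -[leLHS](powRr0 t); apply: ler_powR; apply: ltW.
have fx : Gamma_int x \is a fin_num by rewrite ge0_fin_numE ?Gamma_int_lty ?Gamma_int_ge0.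
move: h; rewrite -Gamma_intS// -(fineK fx) -GammaE G0 mule0 adde0.
by rewrite lee_fin ler10.
Qed.

End Gamma_function.

(** * Recursion of the FARIMA coefficients *)

Section farima_coefficients.
Context {R : realType}.
Implicit Types r : R.

Lemma farima_coef0 r : 0 < r < 1 -> farima_coef r 0 = 1.
Proof.
by move=> r01; rewrite /farima_coef !add0r Gamma1 mul1r divff// Gamma_neq0.
Qed.

Let Gamma_nat_neq0 n : Gamma (n%:R + 1 : R) != 0.
Proof.
elim: n => [|n IH]; first by rewrite add0r Gamma1 oner_eq0.
by rewrite GammaS// mulf_neq0// -natr1.
Qed.

Lemma farima_coefS r n : 0 < r < 1 ->
  farima_coef r n.+1 * n.+1%:R = farima_coef r n * (n%:R + r).
Proof.
move=> r01; have /andP[r0 _] := r01; rewrite /farima_coef.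
have -> : n.+1%:R + r = n%:R + r + 1 by rewrite -natr1 addrAC.
rewrite GammaS; last by rewrite ltr_wpDl.
rewrite GammaS// -natr1.
have := Gamma_nat_neq0 n; have := Gamma_neq0 r01.
have : n%:R + 1 != 0 :> R by rewrite natr1 pnatr_eq0.
move: (Gamma (n%:R + 1)) (Gamma r) (Gamma (n%:R + r)) => x y z n0 y0 x0.
by field; rewrite n0 y0 x0.
Qed.

End farima_coefficients.

(** * Change of density and moments *)

Section change_of_density.
Context {d' : measure_display} {T' : measurableType d'} {R : realType}.
Import HBNNSimple.

(** For simple functions, the integral of [f (phi x) * Z x] involves [Z] only through its integrals
    over preimages under [phi]. Writing the general case as a limit of such sums makes the
    comparison of two weights immediate. *)
Lemma ge0_integral_comp_weight_approx {d : measure_display} {T : measurableType d}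
    (mu : {measure set T -> \bar R}) (phi : T -> T') (Z : T -> R) (f : T' -> R)
    (mf : measurable_fun setT (EFin \o f)) :
  measurable_fun setT phi -> measurable_fun setT Z ->
  (forall x, 0 <= Z x) -> (forall y, 0 <= f y) ->
  let h := nnsfun_approx measurableT mf in
  (\sum_(y \in range (h n)) y%:E *
      \int[mu]_(x in phi @^-1` (h n @^-1` [set y])) (Z x)%:E @[n --> \oo] -->
  \int[mu]_x (f (phi x) * Z x)%:E)%E.
Proof.
move=> mphi mZ Z0 f0 h.
have mhphi n : measurable_fun setT (h n \o phi) by exact: measurableT_comp.
have mZn (A : set T) : measurable A -> measurable_fun A (EFin \o Z).
  by move=> mA; apply/measurable_EFinP; exact: measurable_funTS.
have lim : (\int[mu]_x (h n (phi x) * Z x)%:E @[n --> \oo] -->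
    \int[mu]_x (f (phi x) * Z x)%:E)%E.
  have hcvg x : ((h n (phi x) * Z x)%:E @[n --> \oo] --> (f (phi x) * Z x)%:E)%E.
    have f0' y : setT y -> (0 <= (EFin \o f) y)%E by move=> _; rewrite lee_fin.
    have hf := cvg_nnsfun_approx measurableT mf f0' (x := phi x) I.
    exact: (@cvgeZr _ _ _ _ _ (Z x)%:E isT hf).
  have -> : (\int[mu]_x (f (phi x) * Z x)%:E =
      \int[mu]_x limn (fun n => (h n (phi x) * Z x)%:E))%E.
    by apply: eq_integral => x _; apply/esym; apply: cvg_lim; [by []|exact: hcvg].
  apply: cvg_monotone_convergence => //.
  - by move=> n; apply/measurable_EFinP; exact: (measurable_funM (mhphi n) mZ).
  - by move=> n x _; rewrite lee_fin mulr_ge0.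
  - move=> x _ m n mn; rewrite lee_fin ler_wpM2r//.
    exact/lefP/nd_nnsfun_approx.
apply: cvg_trans lim; apply: near_eq_cvg; apply: nearW => n.
transitivity (\int[mu]_x (\sum_(y \in range (h n))
   (y * \1_(h n @^-1` [set y]) (phi x))%:E * (Z x)%:E))%E.
  apply: eq_integral => x _; rewrite -ge0_mule_fsuml => [|y]; last first.
    exact: nnfun_muleindic_ge0.
  by rewrite fsumEFin// -(fimfunE _ (phi x)) EFinM.
have mi y : measurable_fun setT (fun x => \1_(h n @^-1` [set y]) (phi x) : R).
  by apply: (measurableT_comp (measurable_indic _)).
rewrite ge0_integral_fsum//; last 2 first.
- move=> y; apply/measurable_EFinP; apply: measurable_funM => //.
  exact: measurable_funM.
- move=> y x _; rewrite mule_ge0 ?lee_fin//.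
  exact: (nnfun_muleindic_ge0 (h n) y (phi x)).
apply: eq_fsbigr => y; rewrite inE => -[t _ yt].
have y0 : (0 <= y)%R by rewrite -yt.
under eq_integral do rewrite -EFinM -mulrA EFinM.
rewrite ge0_integralZl//; last 2 first.
- by apply/measurable_EFinP; exact: measurable_funM.
- by move=> x _; rewrite lee_fin mulr_ge0// indicE.
congr (_ * _)%E.
have mA : measurable (phi @^-1` (h n @^-1` [set y])).
  by rewrite -[X in measurable X]setTI; exact: mphi.
rewrite [RHS]integral_mkcond; apply: eq_integral => x _.
rewrite patchE indicE -[phi x \in _]/(x \in phi @^-1` (h n @^-1` [set y])).
by case: ifPn => _; rewrite ?mul1r ?mul0r.
Qed.

(** Two base measures are allowed so as to cover both the law of a normal variable against Lebesgue
    measure with its density, and two weights on one probability space. *)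
Lemma ge0_integral_change_density {d1 d2 : measure_display}
    {T1 : measurableType d1} {T2 : measurableType d2}
    (mu1 : {measure set T1 -> \bar R}) (mu2 : {measure set T2 -> \bar R})
    (phi1 : T1 -> T') (phi2 : T2 -> T') (Z1 : T1 -> R) (Z2 : T2 -> R)
    (f : T' -> R) :
  measurable_fun setT phi1 -> measurable_fun setT phi2 ->
  measurable_fun setT Z1 -> measurable_fun setT Z2 ->
  (forall x, 0 <= Z1 x) -> (forall x, 0 <= Z2 x) ->
  (forall B, measurable B -> \int[mu1]_(x in phi1 @^-1` B) (Z1 x)%:E =
                             \int[mu2]_(x in phi2 @^-1` B) (Z2 x)%:E)%E ->
  measurable_fun setT f -> (forall y, 0 <= f y) ->
  (\int[mu1]_x (f (phi1 x) * Z1 x)%:E = \int[mu2]_x (f (phi2 x) * Z2 x)%:E)%E.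
Proof.
move=> mp1 mp2 mZ1 mZ2 Z10 Z20 H mf f0.
have mf' : measurable_fun setT (EFin \o f) by exact/measurable_EFinP.
have h1 := ge0_integral_comp_weight_approx (mu := mu1) mf' mp1 mZ1 Z10 f0.
have h2 := ge0_integral_comp_weight_approx (mu := mu2) mf' mp2 mZ2 Z20 f0.
move: h1 h2; rewrite /=; set h := nnsfun_approx _ _; set s1 := (X in X @ _ --> _).
set s2 := (X in _ -> X @ _ --> _ -> _) => h1.
have -> : s2 = s1.
  apply/funext => n; apply: eq_fsbigr => y _; rewrite H//.
move=> h2; exact: (cvg_unique _ h1 h2).
Qed.

End change_of_density.

Lemma addr_normr_ge0 {R : realDomainType} (x : R) : 0 <= x + `|x|.
Proof. by rewrite addrC -lerBlDr sub0r ler_normr lexx orbT. Qed.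

Section moments.
Context {d : measure_display} {T : measurableType d} {R : realType}.
Variable P : probability T R.
Implicit Types f g V W Z : T -> R.

Local Notation intg f := (P.-integrable [set: T] (EFin \o f)).

Lemma intg_le f g : measurable_fun setT f -> intg g ->
  (forall x, `|f x| <= g x) -> intg f.
Proof.
move=> mf ig fg; apply: le_integrable ig => //; first exact/measurable_EFinP.
by move=> x _ /=; rewrite lee_fin (le_trans (fg x))// ler_norm.
Qed.

Lemma intg_measurable f : intg f -> measurable_fun setT f.
Proof. by move=> /measurable_int/measurable_EFinP. Qed.

Lemma intgD f g : intg f -> intg g -> intg (fun x => f x + g x).
Proof. by move=> fi gi; exact: (integrableD measurableT fi gi). Qed.

Lemma intgB f g : intg f -> intg g -> intg (fun x => f x - g x).
Proof. by move=> fi gi; exact: (integrableB measurableT fi gi). Qed.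

Lemma intgZ (a : R) f : intg f -> intg (fun x => a * f x).
Proof. by move=> fi; exact: (integrableZl measurableT a fi). Qed.

Lemma intg_cst (a : R) : intg (cst a).
Proof. exact: finite_measure_integrable_cst. Qed.

Lemma intg_norm f : intg f -> intg (fun x => `|f x|).
Proof. by move=> fi; exact: (integrable_norm fi). Qed.

Lemma intg_sum (I : Type) (s : seq I) (F : I -> T -> R) :
  (forall i, intg (F i)) -> intg (fun x => \sum_(i <- s) F i x).
Proof.
move=> Fi; elim: s => [|i s IH].
  apply: eq_integrable (intg_cst 0) => //= x _.
  by rewrite big_nil.
apply: eq_integrable (intgD (Fi i) IH) => //= x _.
by rewrite big_cons.
Qed.

Lemma Rintegral_sum (I : Type) (s : seq I) (F : I -> T -> R) :
  (forall i, intg (F i)) ->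
  \int[P]_x (\sum_(i <- s) F i x) = \sum_(i <- s) \int[P]_x F i x.
Proof.
move=> Fi; elim: s => [|i s IH].
  rewrite big_nil; under eq_Rintegral do rewrite big_nil.
  by rewrite Rintegral_cst// mul0r.
rewrite big_cons; under eq_Rintegral do rewrite big_cons.
by rewrite RintegralD// ?IH//; exact: intg_sum.
Qed.

Lemma Rintegral_prob_cst (a : R) : \int[P]_x (cst a x) = a.
Proof.
have -> : \int[P]_x (cst a x) = a * fine (P setT) by exact: Rintegral_cst.
by rewrite probability_setT mulr1.
Qed.

Lemma intgM f g : measurable_fun setT f -> measurable_fun setT g ->
  intg (fun x => f x ^+ 2) -> intg (fun x => g x ^+ 2) -> intg (fun x => f x * g x).
Proof.
move=> mf mg f2 g2; apply: (intg_le _ (intgD f2 g2)); first exact: measurable_funM.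
move=> x; rewrite ler_norml; apply/andP; split; nra.
Qed.

Lemma intg_indic f (A : set T) : measurable A -> intg f -> intg (fun x => f x * \1_A x).
Proof.
move=> mA fi; apply: (intg_le _ (intg_norm fi)).
  by apply: measurable_funM; [exact: intg_measurable|exact: measurable_indic].
move=> x; rewrite normrM ler_piMr// indicE.
by case: (x \in A); rewrite ?normr1 ?normr0.
Qed.

Lemma Rintegral_indic f (A : set T) :
  \int[P]_(x in A) f x = \int[P]_x (f x * \1_A x).
Proof.
rewrite Rintegral_mkcond; apply: eq_Rintegral => x _.
by rewrite patchE indicE; case: ifP => _; rewrite ?mulr1 ?mulr0.
Qed.

Lemma EFin_Rintegral f (A : set T) : measurable A -> intg f ->
  (\int[P]_(x in A) f x)%:E = (\int[P]_(x in A) (f x)%:E)%E.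
Proof.
move=> mA fi; rewrite fineK//; apply: integrable_fin_num => //.
exact: integrableS fi.
Qed.

(** A class closed under sums, products and powers, so that every polynomial expression below is
    integrable. *)
Definition all_moments V := measurable_fun setT V /\
  forall n, intg (fun x => V x ^+ n).

Lemma all_moments_intg V : all_moments V -> intg V.
Proof. by move=> [mV /(_ 1%N)]. Qed.

Lemma all_moments_cst (a : R) : all_moments (cst a).
Proof. by split => // n; exact: (intg_cst (a ^+ n)). Qed.

Lemma all_momentsM V W : all_moments V -> all_moments W ->
  all_moments (fun x => V x * W x).
Proof.
move=> [mV iV] [mW iW]; split; first exact: measurable_funM.
move=> n; have h : intg (fun x => V x ^+ n * W x ^+ n).
  apply: intgM; [exact: measurable_funX|exact: measurable_funX| |].
  - by apply: eq_integrable (iV (n * 2)%N) => //= x _; rewrite exprM.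
  - by apply: eq_integrable (iW (n * 2)%N) => //= x _; rewrite exprM.
by apply: eq_integrable h => //= x _; rewrite exprMn.
Qed.

Lemma all_momentsX V n : all_moments V -> all_moments (fun x => V x ^+ n).
Proof.
move=> [mV iV]; split; first exact: measurable_funX.
by move=> m; apply: eq_integrable (iV (n * m)%N) => //= x _; rewrite exprM.
Qed.

Lemma all_momentsZ a V : all_moments V -> all_moments (fun x => a * V x).
Proof. exact/all_momentsM/all_moments_cst. Qed.

Lemma all_momentsD V W : all_moments V -> all_moments W ->
  all_moments (fun x => V x + W x).
Proof.
move=> [mV iV] [mW iW]; split; first exact: measurable_funD.
move=> n; have h := intgZ (2 ^+ n) (intgD (intg_norm (iV n)) (intg_norm (iW n))).
apply: (intg_le _ h); first by apply: measurable_funX; exact: measurable_funD.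
move=> x; rewrite !normrX mulrDr -!exprMn.
have [VW|WV] := leP `|V x| `|W x|.
  rewrite (@le_trans _ _ ((2 * `|W x|) ^+ n))//.
    rewrite lerXn2r ?nnegrE ?mulr_ge0// (le_trans (ler_normD _ _))//.
    by rewrite mulr_natl mulr2n lerD2r.
  by rewrite lerDr exprn_ge0// mulr_ge0.
rewrite (@le_trans _ _ ((2 * `|V x|) ^+ n))//.
  rewrite lerXn2r ?nnegrE ?mulr_ge0// (le_trans (ler_normD _ _))//.
  by rewrite mulr_natl mulr2n lerD2l ltW.
by rewrite lerDl exprn_ge0// mulr_ge0.
Qed.

Lemma all_moments_sum (I : Type) (s : seq I) (F : I -> T -> R) :
  (forall i, all_moments (F i)) -> all_moments (fun x => \sum_(i <- s) F i x).
Proof.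
move=> Fi; elim: s => [|i s IH].
  rewrite (_ : (fun x => _) = cst 0); first exact: all_moments_cst.
  by apply/funext => x; rewrite big_nil.
rewrite (_ : (fun x => _) = (fun x => F i x + \sum_(i <- s) F i x)).
  exact: all_momentsD.
by apply/funext => x; rewrite big_cons.
Qed.

(** Serves independence, with [phi] a noise variable, and conditional expectation, with [phi] the
    identity into a smaller sigma-algebra. Both need signed weights and unbounded [f]. *)
Lemma Rintegral_comp_weight_eq {d' : measure_display} {T' : measurableType d'}
    (phi : T -> T') (Z1 Z2 : T -> R) (f : T' -> R) :
  measurable_fun setT phi -> measurable_fun setT f ->
  intg Z1 -> intg Z2 ->
  intg (fun x => f (phi x) * Z1 x) -> intg (fun x => f (phi x) * Z2 x) ->
  (forall B, measurable B -> \int[P]_(x in phi @^-1` B) Z1 x =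
                             \int[P]_(x in phi @^-1` B) Z2 x) ->
  \int[P]_x (f (phi x) * Z1 x) = \int[P]_x (f (phi x) * Z2 x).
Proof.
move=> mphi mf i1 i2 if1 if2 H.
(* Adding the integrable weight [G] to both densities makes them nonnegative. *)
pose G x := `|Z1 x| + `|Z2 x|.
have iG : intg G by apply: intgD; exact: intg_norm.
have mG := intg_measurable iG.
have mZ1 := intg_measurable i1; have mZ2 := intg_measurable i2.
have key (g : T' -> R) : measurable_fun setT g -> (forall y, 0 <= g y) ->
    (forall y, g y <= 2 * `|f y|) ->
    \int[P]_x (g (phi x) * Z1 x) = \int[P]_x (g (phi x) * Z2 x).
  move=> mg g0 gf.
  have igZ Z : measurable_fun setT Z -> intg (fun x => f (phi x) * Z x) ->
      intg (fun x => g (phi x) * Z x).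
    move=> mZ ifZ; apply: (intg_le _ (intgZ 2 (intg_norm ifZ))).
      by apply: measurable_funM => //; exact: measurableT_comp.
    move=> x; rewrite !normrM mulrA ler_wpM2r// ger0_norm//.
  have igG : intg (fun x => g (phi x) * G x).
    have h := intgD (intg_norm (igZ _ mZ1 if1)) (intg_norm (igZ _ mZ2 if2)).
    apply: eq_integrable h => //= x _; congr EFin.
    by rewrite !normrM ger0_norm// mulrDr.
  have e := @ge0_integral_change_density _ T' R _ _ T T P P phi phi
    (fun x => Z1 x + G x) (fun x => Z2 x + G x) g mphi mphi.
  have {e} : \int[P]_x (g (phi x) * (Z1 x + G x)) = \int[P]_x (g (phi x) * (Z2 x + G x)).
    congr fine; apply: e => //.
    - exact: measurable_funD.
    - exact: measurable_funD.
    - by move=> x; rewrite /G addrA addr_ge0 ?addr_normr_ge0.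
    - by move=> x; rewrite /G addrCA addr_ge0 ?addr_normr_ge0.
    - move=> B mB; have mphiB : measurable (phi @^-1` B).
        by rewrite -[X in measurable X]setTI; exact: mphi.
      rewrite -(EFin_Rintegral mphiB (intgD i1 iG)) -(EFin_Rintegral mphiB (intgD i2 iG)).
      have iS f' : intg f' -> P.-integrable (phi @^-1` B) (EFin \o f').
        by apply: integrableS.
      by rewrite (RintegralD mphiB (iS _ i1) (iS _ iG)) (RintegralD mphiB (iS _ i2) (iS _ iG)) H.
  under eq_Rintegral do rewrite mulrDr.
  under [RHS]eq_Rintegral do rewrite mulrDr.
  rewrite (RintegralD measurableT (igZ _ mZ1 if1) igG).
  by rewrite (RintegralD measurableT (igZ _ mZ2 if2) igG) => /addIr.
have mnf : measurable_fun setT (fun y => `|f y|) by exact: measurableT_comp.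
have inf Z : measurable_fun setT Z -> intg (fun x => f (phi x) * Z x) ->
    intg (fun x => `|f (phi x)| * Z x).
  move=> mZ ifZ; apply: (intg_le _ (intg_norm ifZ)).
    by apply: measurable_funM => //; exact: (measurableT_comp mnf).
  by move=> x; rewrite !normrM normr_id.
(* The function [f] is the difference of $f+|f|$ and $|f|$, both nonnegative and at most $2|f|$, so
   that [key] covers them. *)
have e1 := key (fun y => `|f y|) mnf (fun=> normr_ge0 _).
have e2 := key (fun y => f y + `|f y|).
have {}e1 : \int[P]_x (`|f (phi x)| * Z1 x) = \int[P]_x (`|f (phi x)| * Z2 x).
  by apply: e1 => y; rewrite ler_peMl// ler1n.
have {}e2 : \int[P]_x ((f (phi x) + `|f (phi x)|) * Z1 x) =
    \int[P]_x ((f (phi x) + `|f (phi x)|) * Z2 x).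
  apply: e2; first exact: measurable_funD.
    by move=> y; exact: addr_normr_ge0.
  by move=> y; rewrite mulr_natl mulr2n lerD2r ler_norm.
move: e2; under eq_Rintegral do rewrite mulrDl.
under [X in _ = X -> _]eq_Rintegral do rewrite mulrDl.
rewrite (RintegralD measurableT if1 (inf _ mZ1 if1)).
by rewrite (RintegralD measurableT if2 (inf _ mZ2 if2)) e1 => /addIr.
Qed.

End moments.

(** * Gaussian moments *)

(* [v] is the variance, not the standard deviation. *)
Fixpoint gauss_moment {R : realType} (v : R) (n : nat) : R :=
  if n is m.+1 then (if m is k.+1 then m%:R * v * gauss_moment v k else 0)
  else 1.

Lemma gauss_momentSS {R : realType} (v : R) n :
  gauss_moment v n.+2 = n.+1%:R * v * gauss_moment v n.
Proof. by []. Qed.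

Lemma gauss_moment_ind (Q : nat -> Prop) :
  Q 0 -> Q 1 -> (forall n, Q n -> Q n.+2) -> forall n, Q n.
Proof.
move=> Q0 Q1 QS n; suff : Q n /\ Q n.+1 by case.
by elim: n => [//|n [Qn QSn]]; split => //; exact: QS.
Qed.

Lemma gauss_moment_odd {R : realType} (v : R) n : odd n -> gauss_moment v n = 0.
Proof.
by elim/gauss_moment_ind: n => // n IH; rewrite gauss_momentSS /= negbK => /IH ->; rewrite mulr0.
Qed.

Lemma is_derive_exprn {R : realType} n (x : R) :
  is_derive x 1 (fun y : R => y ^+ n) (n%:R * x ^+ n.-1).
Proof.
rewrite (_ : (fun y : R => y ^+ n) = (@id R : R -> R) ^+ n); last first.
  by apply/funext => y; rewrite exprfctE.
by apply: is_derive_eq; rewrite /GRing.scale/= mulr1.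
Qed.

Section normal_moments.
Context {R : realType}.
Notation mu := (@lebesgue_measure R).
Local Notation p := (normal_pdf (0 : R) 1).

Lemma std_normal_pdfE (x : R) : p x = normal_peak 1 * expR (- (x ^+ 2 / 2)).
Proof.
by rewrite normal_pdfE ?oner_neq0// /normal_fun subr0 expr1n mulNr.
Qed.

Lemma std_normal_pdfN (x : R) : p (- x) = p x.
Proof. by rewrite !std_normal_pdfE sqrrN. Qed.

Lemma is_derive_std_normal_pdf (x : R) : is_derive x 1 p (- x * p x).
Proof.
rewrite (_ : (p : R -> R) = (fun x => normal_peak 1 * expR (- (x ^+ 2 / 2)))); last first.
  by apply/funext => y; rewrite std_normal_pdfE.
apply: is_derive_eq; rewrite /GRing.scale/=; rewrite !mulr0 add0r mulr1.
by rewrite -mulr2n -(mulr_natl x) mulKf ?pnatr_eq0//; ring.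
Qed.

Let measurable_p : measurable_fun setT p.
Proof. exact: measurable_normal_pdf. Qed.

(** For $x\ge2$ one has $x^2/2\ge x$, which reduces the Gaussian tail to the exponential one. *)
Lemma cvgn_std_normal_tail k : n.+2%:R ^+ k * p n.+2%:R @[n --> \oo] --> 0.
Proof.
apply: (@squeeze_cvgr _ _ _ _ (fun=> 0)
  (fun n => normal_peak 1 * (n.+2%:R `^ k%:R * expR (- n.+2%:R)))).
- apply: nearW => n; rewrite mulr_ge0 ?exprn_ge0 ?normal_pdf_ge0//=.
  rewrite std_normal_pdfE mulrCA powR_mulrn// ler_wpM2l ?normal_peak_ge0//.
  rewrite ler_wpM2l ?exprn_ge0// ler_expR lerN2 expr2 -mulrA.
  by rewrite ler_peMr// ler_pdivlMr// mul1r ler_nat.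
- exact: cvg_cst.
- rewrite -[X in _ --> X](mulr0 (normal_peak 1)); apply: cvgMr.
  exact: cvgn_powR_expRN.
Qed.

(** Since $p'=-xp$, the derivative of $x^{n+1}p$ is $(n+1)x^np-x^{n+2}p$; evenness of [n] keeps both
    terms nonnegative, so finiteness need not be known beforehand. *)
Lemma integral_normal_even_momentS n : ~~ odd n ->
  (n.+1%:R%:E * \int[mu]_x (x ^+ n * p x)%:E = \int[mu]_x (x ^+ n.+2 * p x)%:E)%E.
Proof.
move=> n2.
have pge0 (m : nat) (x : R) : ~~ odd m -> 0 <= x ^+ m * p x.
  by move=> m2; rewrite mulr_ge0 ?normal_pdf_ge0// exprn_even_ge0.
have cont (m : nat) (x : R) : {for x, continuous (fun x : R => x ^+ m * p x)}.
  apply: cvgM; last exact: continuous_normal_pdf.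
  exact: exprn_continuous.
rewrite -ge0_integralZl//; last 2 first.
- apply/measurable_EFinP; apply: measurable_funM => //; exact: measurable_funX.
- by move=> x _; rewrite lee_fin pge0.
under eq_integral do rewrite -EFinM.
rewrite -[RHS]add0e.
apply: (@ge0_FTC2_exhaust _ (fun x => x ^+ n.+1 * p x) _ _
  (fun n => - n.+2%:R) (fun n => n.+2%:R) _ 0).
- by move=> m; rewrite (@lt_trans _ _ 0)// oppr_lt0.
- by move=> a b ab; rewrite lerN2 ler_nat !ltnS.
- by move=> a b ab; rewrite ler_nat !ltnS.
- apply/seteqP; split => // x _.
  exists (Num.truncn `|x|) => //=; rewrite in_itv/= -ler_norml ltW//.
  by rewrite (lt_le_trans (truncnS_gt _))// ler_nat.
- by move=> x _; rewrite mulr_ge0// pge0.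
- by move=> x _; rewrite pge0//= negbK.
- by move=> x _; apply: cvgMr; exact: cont.
- by move=> x _; exact: cont.
- move=> x _; have h := is_derive_std_normal_pdf x.
  have h1 := is_derive_exprn n.+1 x.
  by apply: is_derive_eq; rewrite /GRing.scale/= !exprS; ring.
- rewrite -[X in _ --> X](subrr (0 : R)); apply: cvgB; first exact: cvgn_std_normal_tail.
  have e m : (- m.+2%:R) ^+ n.+1 * p (- m.+2%:R) =
      (-1) ^+ n.+1 * (m.+2%:R ^+ n.+1 * p m.+2%:R).
    by rewrite std_normal_pdfN exprNn mulrA.
  rewrite (funext e) -[X in _ --> X](mulr0 ((-1) ^+ n.+1)); apply: cvgMr.
  exact: cvgn_std_normal_tail.
Qed.

Lemma ge0_integral_oppr (f : R -> R) : measurable_fun setT f -> (forall x, 0 <= f x) ->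
  (\int[mu]_x (f (- x))%:E = \int[mu]_x (f x)%:E)%E.
Proof.
move=> mf f0.
transitivity (\int[pushforward mu (-%R : _ -> measurableTypeR R)]_x (f x)%:E)%E.
  rewrite ge0_integral_pushforward//; first by exact/measurable_EFinP.
  by move=> x _; rewrite lee_fin.
by apply: eq_measure_integral => A mA _; exact: lebesgue_measureN.
Qed.

Lemma integral_normal_even_moment n : ~~ odd n ->
  (\int[mu]_x (x ^+ n * p x)%:E = (gauss_moment 1 n)%:E)%E.
Proof.
elim/gauss_moment_ind: n => [_|//|n IH].
  under eq_integral do rewrite expr0 mul1r.
  exact: integral_normal_pdf.
move=> n2; have {}n2 : ~~ odd n by rewrite /= negbK in n2.
by rewrite -integral_normal_even_momentS// IH// gauss_momentSS mulr1 EFinM.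
Qed.

Context {d : measure_display} {T : measurableType d} (P : probability T R).
Variable e : {RV P >-> R}.
Hypothesis he : forall B : set R, measurable B -> distribution P e B = normal_prob 0 1 B.

Let me : measurable_fun setT e.
Proof. exact: measurable_funPT. Qed.

Let meX n : measurable_fun setT (fun x => e x ^+ n).
Proof. exact: (measurable_funX n me). Qed.

Let mX n : measurable_fun setT (fun x : R => x ^+ n).
Proof. exact: measurable_funX. Qed.

Lemma ge0_integral_std_normal (f : R -> R) : measurable_fun setT f ->
  (forall x, 0 <= f x) ->
  (\int[P]_x (f (e x))%:E = \int[mu]_x (f x * p x)%:E)%E.
Proof.
move=> mf f0.
under eq_integral do rewrite -[f _]mulr1.
apply: (@ge0_integral_change_density _ R R _ _ T (measurableTypeR R) P mu e id (cst 1) p f) => //.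
- by move=> x; exact: normal_pdf_ge0.
- move=> B mB; have := he mB; rewrite /distribution /pushforward/= => h.
  by rewrite integral_cst ?mul1e// -[X in measurable X]setTI; exact: measurable_funPT.
Qed.

Lemma all_moments_std_normal : all_moments P e.
Proof.
have even n : P.-integrable setT (EFin \o (fun x => e x ^+ (n * 2))).
  apply/integrableP; split.
    exact/measurable_EFinP.
  under eq_integral => x _.
    rewrite /= ger0_norm; last by rewrite mulnC exprM exprn_ge0// sqr_ge0.
    over.
  rewrite (@ge0_integral_std_normal (fun y => y ^+ (n * 2)))//.
  - by rewrite integral_normal_even_moment ?ltry// oddM andbF.
  - by move=> x; rewrite exprn_even_ge0// oddM andbF.
split => // n.
apply: (intg_le _ (intgD (intg_cst P 1) (even n))).
  exact: meX.
move=> x /=; rewrite exprM; set y := e x ^+ n.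
rewrite ler_norml; apply/andP; split; nra.
Qed.

Lemma Rintegral_std_normal_moment n :
  \int[P]_x (e x ^+ n) = gauss_moment 1 n.
Proof.
have [ne|no] := boolP (odd n); last first.
  rewrite /Rintegral (@ge0_integral_std_normal (fun y => y ^+ n))//.
  - by rewrite integral_normal_even_moment.
  - by move=> x; rewrite exprn_even_ge0.
have [_ /(_ n) ie] := all_moments_std_normal.
have ine : P.-integrable setT (EFin \o (fun x => `|e x ^+ n|)) by exact: intg_norm.
rewrite gauss_moment_odd//.
have mN : measurable_fun setT (fun y : R => `|y ^+ n|) by exact: measurableT_comp.
(* Only nonnegative functions are transferred to Lebesgue measure. For odd [n], the functions
   $x^n+|x^n|$ and $|x^n|-x^n$ are exchanged by $x\mapsto-x$, which preserves the density, so the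
   odd moment vanishes. *)
have : \int[P]_x (e x ^+ n + `|e x ^+ n|) = \int[P]_x (`|e x ^+ n| - e x ^+ n).
  rewrite /Rintegral.
  rewrite (@ge0_integral_std_normal (fun y => y ^+ n + `|y ^+ n|)); last 2 first.
  - exact: measurable_funD.
  - by move=> y; exact: addr_normr_ge0.
  rewrite (@ge0_integral_std_normal (fun y => `|y ^+ n| - y ^+ n)); last 2 first.
  - exact: measurable_funB.
  - by move=> y; rewrite subr_ge0 ler_norm.
  rewrite -[in RHS]ge0_integral_oppr; last 2 first.
  - apply: measurable_funM => //; exact: measurable_funB.
  - by move=> y; rewrite mulr_ge0 ?normal_pdf_ge0// subr_ge0 ler_norm.
  congr fine; apply: eq_integral => y _; rewrite std_normal_pdfN exprNn.
  by rewrite -signr_odd ne expr1 mulN1r normrN opprK addrC.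
rewrite RintegralD// RintegralB//.
by set a := Rintegral _ _ _; set b := Rintegral _ _ _; lra.
Qed.

End normal_moments.

(** The moments of a sum of two independent centred Gaussian variables, in algebraic form. Pascal's
    rule splits the sum into two, which match the two halves of $(n+1)(v+w)$ in the recursion. *)
Lemma gauss_momentD {R : realType} (v w : R) n :
  gauss_moment (v + w) n =
  \sum_(l < n.+1) (gauss_moment v (n - l) * gauss_moment w l) *+ 'C(n, l).
Proof.
elim/gauss_moment_ind: n => [||n IH].
- by rewrite big_ord1/= mulr1.
- by rewrite !big_ord_recr big_ord0/= mulr0 mul0r !mul0rn !addr0.
pose f l := gauss_moment v (n.+2 - l) * gauss_moment w l.
have -> : \sum_(l < n.+3) (gauss_moment v (n.+2 - l) * gauss_moment w l) *+ 'C(n.+2, l)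
    = \sum_(l < n.+3) f l *+ 'C(n.+1, l) + \sum_(l < n.+2) f l.+1 *+ 'C(n.+1, l).
  rewrite big_ord_recl [X in _ = X + _]big_ord_recl -addrA; congr (_ + _).
  by rewrite -big_split/=; apply: eq_bigr => i _; rewrite /bump/= add1n binS mulrnDr.
(* One factor $v$ is peeled off each term, through $(n+1-i)\binom{n+1}{i}=(n+1)\binom{n}{i}$. *)
have -> : \sum_(l < n.+3) f l *+ 'C(n.+1, l) = n.+1%:R * v * gauss_moment (v + w) n.
  rewrite IH big_ord_recr big_ord_recr/= (@bin_small n.+1 n.+2)// mulr0n addr0.
  rewrite {2}/f subSn// subnn mul0r mul0rn addr0 mulr_sumr; apply: eq_bigr => i _.
  have ni : (i <= n)%N by rewrite -ltnS.
  have e : (n.+1 - i = (n - i).+1)%N by rewrite subSn.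
  rewrite /f (subSn (leqW ni)) e gauss_momentSS -[LHS]mulr_natl -[X in _ = _ * X]mulr_natl.
  have -> : 'C(n.+1, i)%:R * ((n - i).+1%:R * v * gauss_moment v (n - i) * gauss_moment w i) =
      (((n - i).+1 * 'C(n.+1, i))%N)%:R * (v * gauss_moment v (n - i) * gauss_moment w i).
    by rewrite natrM; ring.
  by rewrite -e -mul_bin_down/= natrM; ring.
rewrite big_ord_recl/= {1}/f/= mulr0 mul0rn add0r.
rewrite mulrDr mulrDl; congr (_ + _).
rewrite IH mulr_sumr; apply: eq_bigr => i _; symmetry.
rewrite /f /bump/= add1n !subSS -[LHS]mulr_natl -[X in _ = _ * X]mulr_natl.
transitivity ((((i.+1) * 'C(n.+1, i.+1))%N)%:R *
    (w * gauss_moment v (n - i) * gauss_moment w i)).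
  by rewrite natrM; ring.
by rewrite -mul_bin_diag/= natrM; ring.
Qed.

Lemma gauss_momentZ {R : realType} (a v : R) n :
  gauss_moment (a ^+ 2 * v) n = a ^+ n * gauss_moment v n.
Proof.
elim/gauss_moment_ind: n => [||n IH]; rewrite ?expr0 ?mul1r ?mulr0//.
by rewrite !gauss_momentSS IH !exprS; ring.
Qed.

(** * Independence and moments of linear combinations of the noise *)

Section independence.
Context {d : measure_display} {T : measurableType d} {R : realType}.
Variables (P : probability T R) (eps : int -> {RV P >-> R}).
Hypothesis heps : iid_std_normal eps.

Local Notation intg f := (P.-integrable [set: T] (EFin \o f)).

Let cyl (s : seq int) (B : int -> set R) := \bigcap_(i in [set` s]) eps i @^-1` B i.

Let meps i : measurable_fun setT (eps i).
Proof. exact: measurable_funPT. Qed.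

Let mpre i B : measurable B -> measurable (eps i @^-1` B).
Proof. by move=> mB; rewrite -[X in measurable X]setTI; exact: meps. Qed.

Let mcyl s B : (forall i, measurable (B i)) -> measurable (cyl s B).
Proof.
move=> mB; apply: fin_bigcap_measurable => [|i _]; first exact: finite_seq.
exact: mpre.
Qed.

(** Independence of [Z] from the noise outside [s], tested on finite cylinders only: this is the
    form in which mutual independence is given, it is linear in [Z], and it extends one index at a
    time. *)
Definition indep_of (s : seq int) (Z : T -> R) := intg Z /\
  forall s2 B, uniq s2 -> (forall i, i \in s2 -> i \notin s) ->
    (forall i, measurable (B i)) ->
    \int[P]_(x in \bigcap_(i in [set` s2]) eps i @^-1` B i) Z x =
    (\int[P]_x Z x) * \prod_(i <- s2) fine (P (eps i @^-1` B i)).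

(** The base case, where the product formula for the noise is used. *)
Lemma indep_of_cst (a : R) : indep_of [::] (cst a).
Proof.
split; first exact: intg_cst.
move=> s2 B us2 _ mB; rewrite Rintegral_prob_cst.
have -> : \int[P]_(x in cyl s2 B) cst a x = a * fine (P (cyl s2 B)).
  by apply: Rintegral_cst; exact: mcyl.
congr (_ * _); have [/(_ s2 B us2 mB) -> _] := heps.
elim: s2 {us2} => [|i s IH]; rewrite ?big_nil// !big_cons -IH fineM//.
  by rewrite fin_num_measure//; exact: mpre.
rewrite prode_fin_num// => j _.
by rewrite fin_num_measure//; exact: mpre.
Qed.

Lemma indep_ofD s Z W : indep_of s Z -> indep_of s W ->
  indep_of s (fun x => Z x + W x).
Proof.
move=> [iZ hZ] [iW hW]; split; first exact: intgD.
move=> s2 B us2 s2s mB.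
have iS f : intg f -> P.-integrable (cyl s2 B) (EFin \o f).
  by apply: integrableS => //; exact: mcyl.
rewrite (RintegralD (mcyl s2 mB) (iS _ iZ) (iS _ iW)) hZ// hW//.
by rewrite (RintegralD measurableT iZ iW) mulrDl.
Qed.

Lemma indep_ofZ s (a : R) Z : indep_of s Z -> indep_of s (fun x => a * Z x).
Proof.
move=> [iZ hZ]; split; first exact: intgZ.
move=> s2 B us2 s2s mB.
have iS f : intg f -> P.-integrable (cyl s2 B) (EFin \o f).
  by apply: integrableS => //; exact: mcyl.
by rewrite (RintegralZl a (mcyl s2 mB) (iS _ iZ)) hZ// (RintegralZl a measurableT iZ) mulrA.
Qed.

Lemma indep_of_cons0 i s Z : indep_of s Z -> indep_of (i :: s) Z.
Proof.
move=> [iZ hZ]; split => // s2 B us2 s2s mB; apply: hZ => // j /s2s.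
by rewrite inE negb_or => /andP[].
Qed.

Lemma indep_of_nil s : indep_of s (cst 0).
Proof. by elim: s => [|i s]; [exact: indep_of_cst|exact: indep_of_cons0]. Qed.

Lemma indep_of_sum (I : Type) (r : seq I) s (F : I -> T -> R) :
  (forall i, indep_of s (F i)) -> indep_of s (fun x => \sum_(i <- r) F i x).
Proof.
move=> Fi; elim: r => [|i r IH].
  rewrite (_ : (fun x => _) = cst 0); first exact: indep_of_nil.
  by apply/funext => x; rewrite big_nil.
rewrite (_ : (fun x => _) = (fun x => F i x + \sum_(i <- r) F i x)).
  exact: indep_ofD.
by apply/funext => x; rewrite big_cons.
Qed.

(** Over the events of [eps i], the variable [Z] times the indicator of a cylinder has the same
    integrals as a constant, and so has it against any function of [eps i]. The cylinder without
    constraints gives the product of expectations. *)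
Lemma indep_of_mul i s Z (g : R -> R) : indep_of s Z -> i \notin s ->
  measurable_fun setT g -> intg (g \o eps i) -> intg (fun x => g (eps i x) * Z x) ->
  indep_of (i :: s) (fun x => g (eps i x) * Z x) /\
  \int[P]_x (g (eps i x) * Z x) = (\int[P]_x g (eps i x)) * \int[P]_x Z x.
Proof.
move=> [iZ hZ] si mg ig igZ.
have key s2 B : uniq s2 -> (forall j, j \in s2 -> j \notin i :: s) ->
    (forall j, measurable (B j)) ->
    \int[P]_(x in cyl s2 B) (g (eps i x) * Z x) = (\int[P]_x g (eps i x)) *
    ((\int[P]_x Z x) * \prod_(j <- s2) fine (P (eps j @^-1` B j))).
  move=> us2 s2s mB; rewrite Rintegral_indic; set c := _ * \prod_(_ <- _) _.
  have mc := mcyl s2 mB.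
  under eq_Rintegral do rewrite -mulrA.
  rewrite (@Rintegral_comp_weight_eq _ _ _ P _ R (eps i)
    (fun x => Z x * \1_(cyl s2 B) x) (cst c) g)//.
  - by rewrite -(RintegralZr c measurableT ig).
  - exact: intg_indic.
  - exact: intg_cst.
  - by under eq_fun do rewrite mulrA; exact: (intg_indic mc igZ).
  - rewrite (_ : (fun x => _) = (fun x => c * g (eps i x))); first exact: (intgZ c ig).
    by apply/funext => x; rewrite mulrC.
  (* The event [D] for [eps i] becomes one more constraint of the cylinder, at the fresh index
     [i]. *)
  move=> D mD; pose B' j := if j == i then D else B j.
  have is2 : i \notin s2.
    by apply/negP => /s2s; rewrite inE eqxx.
  have mB' j : measurable (B' j) by rewrite /B'; case: ifP.
  have e j : j \in s2 -> B' j = B j.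
    by move=> js2; rewrite /B' ifF//; apply: contraNF is2 => /eqP <-.
  have cylE : cyl (i :: s2) B' = (eps i @^-1` D) `&` cyl s2 B.
    apply/seteqP; split => x.
      move=> h; split.
        by have := h i; rewrite /= inE eqxx /B' eqxx; apply.
      by move=> j/= js2; have := h j; rewrite /= inE js2 orbT e//; apply.
    move=> [h1 h2] j /=; rewrite inE => /predU1P[->|js2].
      by rewrite /B' eqxx.
    by rewrite e//; exact: (h2 j).
  have := hZ (i :: s2) B'; rewrite -/(cyl _ _) cylE.
  rewrite Rintegral_mkcondr => h.
  transitivity (\int[P]_(x in eps i @^-1` D) (Z \_ (cyl s2 B)) x).
    apply: eq_Rintegral => x _; rewrite patchE indicE.
    by case: ifP => _; rewrite ?mulr1 ?mulr0.
  rewrite h//=; last 2 first.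
  - by rewrite is2.
  - move=> j; rewrite inE => /predU1P[->//|/s2s].
    by rewrite inE negb_or => /andP[].
  rewrite big_cons {1}/B' eqxx.
  have -> : \int[P]_(x in eps i @^-1` D) cst c x = c * fine (P (eps i @^-1` D)).
    by apply: Rintegral_cst; exact: mpre.
  rewrite /c mulrCA mulrC; congr (_ * _ * _).
  by apply: eq_big_seq => j js2; rewrite e.
have E : \int[P]_x (g (eps i x) * Z x) = (\int[P]_x g (eps i x)) * \int[P]_x Z x.
  have := key [::] (fun=> setT); rewrite /cyl big_nil mulr1 set_nil bigcap_set0.
  by apply.
split => //; split => // s2 B us2 s2s mB.
by rewrite -/(cyl s2 B) key// E mulrA.
Qed.

Lemma std_normal_all_moments i : all_moments P (eps i).
Proof. by have [_ h] := heps; apply: all_moments_std_normal; exact: h. Qed.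

Lemma std_normal_moment i n : \int[P]_x (eps i x ^+ n) = gauss_moment 1 n.
Proof. by have [_ h] := heps; apply: Rintegral_std_normal_moment; exact: h. Qed.

(** Both claims need one induction on [s] for all powers at once: the binomial expansion of
    $(a_i\varepsilon_i+V)^n$ uses the independence of the lower powers of $V$ from $\varepsilon_i$,
    and [gauss_momentD] resums it. *)
Lemma lin_comb_moments (s : seq int) (a : int -> R) n : uniq s ->
  let V x := \sum_(i <- s) a i * eps i x in
  indep_of s (fun x => V x ^+ n) /\
  \int[P]_x (V x ^+ n) = gauss_moment (\sum_(i <- s) a i ^+ 2) n.
Proof.
have amV s' : all_moments P (fun x => \sum_(i <- s') a i * eps i x).
  by apply: all_moments_sum => i; apply: all_momentsZ; exact: std_normal_all_moments.
elim: s n => [n _|i s IH n] /=.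
  under eq_fun do rewrite big_nil.
  rewrite big_nil; split; first exact: (indep_of_cst (0 ^+ n)).
  have -> : \int[P]_x (0 ^+ n) = 0 ^+ n :> R by exact: Rintegral_prob_cst.
  elim/gauss_moment_ind: n => //= n _.
  by rewrite exprS mul0r mulr0 mul0r.
move=> /andP[si us].
pose V x := \sum_(i <- s) a i * eps i x.
pose F (l : 'I_n.+1) x := ('C(n, l)%:R * a i ^+ l) * (eps i x ^+ l * V x ^+ (n - l)).
have VE x : (\sum_(j <- i :: s) a j * eps j x) ^+ n = \sum_(l < n.+1) F l x.
  rewrite big_cons addrC exprDn; apply: eq_bigr => l _.
  by rewrite /F exprMn -[LHS]mulr_natl /V; ring.
have hl (l : 'I_n.+1) := @indep_of_mul i s (fun x => V x ^+ (n - l)) (fun y => y ^+ l)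
  (IH (n - l)%N us).1 si.
have {}hl (l : 'I_n.+1) : indep_of (i :: s) (fun x => eps i x ^+ l * V x ^+ (n - l)) /\
    \int[P]_x (eps i x ^+ l * V x ^+ (n - l)) =
    (\int[P]_x (eps i x ^+ l)) * \int[P]_x (V x ^+ (n - l)).
  apply: hl; first exact: exprn_measurable.
    by have [_] := std_normal_all_moments i; apply.
  apply: all_moments_intg; apply: all_momentsM; apply: all_momentsX.
    exact: std_normal_all_moments.
  exact: amV.
have hF l : indep_of (i :: s) (F l) by apply: indep_ofZ; exact: (hl l).1.
split.
  by under eq_fun do rewrite VE; exact: indep_of_sum.
under eq_Rintegral do rewrite VE.
rewrite Rintegral_sum; last by move=> l; have [] := hF l.
rewrite big_cons addrC gauss_momentD; apply: eq_bigr => l _.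
rewrite /F RintegralZl//; last by have [[]] := hl l.
rewrite (hl l).2 std_normal_moment (IH _ us).2.
by rewrite -[a i ^+ 2]mulr1 gauss_momentZ -[RHS]mulr_natl; ring.
Qed.

End independence.

Lemma exprn_lipschitz {R : realFieldType} (M x y : R) n :
  0 <= x <= M -> 0 <= y <= M -> `|x ^+ n.+1 - y ^+ n.+1| <= n.+1%:R * M ^+ n * `|x - y|.
Proof.
move=> /andP[x0 xM] /andP[y0 yM]; elim: n => [|n IH]; first by rewrite expr0 !mul1r.
have M0 := le_trans x0 xM.
have -> : x ^+ n.+2 - y ^+ n.+2 = x * (x ^+ n.+1 - y ^+ n.+1) + (x - y) * y ^+ n.+1.
  by rewrite (exprS x n.+1) (exprS y n.+1); ring.
rewrite (le_trans (ler_normD _ _))// !normrM (ger0_norm x0) normrX (ger0_norm y0).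
rewrite -[n.+2%:R]natr1 mulrDl mul1r mulrDl lerD//; last first.
  by rewrite mulrC ler_wpM2r// lerXn2r// nnegrE.
apply: (le_trans (ler_wpM2l x0 IH)).
apply: (le_trans (ler_wpM2r _ xM)); first by rewrite !mulr_ge0// exprn_ge0.
by rewrite exprS le_eqVlt; apply/orP; left; apply/eqP; ring.
Qed.

Lemma norm_exprnB_le {R : realFieldType} (x y : R) n :
  `|x ^+ n.+1 - y ^+ n.+1| <= n.+1%:R * (`|x - y| * (`|x| ^+ n + `|y| ^+ n)).
Proof.
wlog xy : x y / `|y| <= `|x|.
  move=> H; have [/H//|/ltW/H] := leP `|y| `|x|.
  by rewrite distrC [`|y - x|]distrC [`|y| ^+ n + _]addrC.
have h : `|x ^+ n.+1 - y ^+ n.+1| <= n.+1%:R * `|x| ^+ n * `|x - y|.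
  rewrite subrXX mulrAC -mulrA normrM [leRHS]mulrC -mulrA ler_wpM2l//.
  rewrite (le_trans (ler_norm_sum _ _ _))//.
  rewrite mulrC mulr_natl -[X in _ *+ X]card_ord -sumr_const ler_sum// => i _.
  have -> : `|x| ^+ n = `|x| ^+ (n - i) * `|x| ^+ i by rewrite -exprD subnK// -ltnS.
  rewrite normrM !normrX ler_wpM2l ?exprn_ge0//.
  by rewrite lerXn2r ?nnegrE.
apply: (le_trans h); rewrite -mulrA ler_wpM2l// mulrC ler_wpM2l//.
by rewrite lerDl exprn_ge0.
Qed.

Lemma gauss_moment_le {R : realType} (v w : R) n : 0 <= v <= w ->
  0 <= gauss_moment v n <= gauss_moment w n.
Proof.
move=> /andP[v0 vw]; elim/gauss_moment_ind: n => [||n /andP[h1 h2]].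
- by rewrite /= ler01 lexx.
- by rewrite /= lexx.
rewrite !gauss_momentSS !mulr_ge0//= ler_pM ?mulr_ge0//.
by rewrite ler_wpM2l.
Qed.

Lemma cvgn_gauss_moment {R : realType} (v_ : nat -> R) (v : R) n :
  v_ k @[k --> \oo] --> v ->
  gauss_moment (v_ k) n @[k --> \oo] --> gauss_moment v n.
Proof.
move=> hv; elim/gauss_moment_ind: n => [||n IH]; [exact: cvg_cst|exact: cvg_cst|].
by apply: cvgM => //; apply: cvgMr.
Qed.

(** * Gaussian variables and their limits *)

Section gaussian.
Context {d : measure_display} {T : measurableType d} {R : realType}.
Variable P : probability T R.
Implicit Types f g V W : T -> R.

Local Notation intg f := (P.-integrable [set: T] (EFin \o f)).

Lemma cauchy_schwarz f g : measurable_fun setT f -> measurable_fun setT g ->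
  intg (fun x => f x ^+ 2) -> intg (fun x => g x ^+ 2) ->
  (\int[P]_x (f x * g x)) ^+ 2 <= (\int[P]_x (f x ^+ 2)) * \int[P]_x (g x ^+ 2).
Proof.
move=> mf mg if2 ig2; have ifg := intgM mf mg if2 ig2.
set a := \int[P]_x (f x ^+ 2); set b := \int[P]_x (f x * g x).
set c := \int[P]_x (g x ^+ 2).
have a0 : 0 <= a by apply: Rintegral_ge0 => x _; exact: sqr_ge0.
have c0 : 0 <= c by apply: Rintegral_ge0 => x _; exact: sqr_ge0.
have key s t : 0 <= s ^+ 2 * a + (2 * s * t) * b + t ^+ 2 * c.
  rewrite -(RintegralZl (s ^+ 2) measurableT if2) -(RintegralZl _ measurableT ifg).
  rewrite -(RintegralZl _ measurableT ig2).
  rewrite -(RintegralD measurableT (intgZ _ if2) (intgZ _ ifg)).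
  rewrite -(RintegralD measurableT (intgD (intgZ _ if2) (intgZ _ ifg)) (intgZ _ ig2)).
  apply: Rintegral_ge0 => x _.
  have -> : s ^+ 2 * f x ^+ 2 + 2 * s * t * (f x * g x) + t ^+ 2 * g x ^+ 2 =
    (s * f x + t * g x) ^+ 2 by ring.
  exact: sqr_ge0.
have [c00|c00] := eqVneq c 0.
  have [->|b0] := eqVneq b 0; first by rewrite expr0n/= mulr_ge0.
  (* If $c=0$ and $b\ne0$, this choice would give the quadratic form the value $-1$. *)
  have := key 1 (- (a + 1) / (2 * b)).
  rewrite c00 mulr0 addr0 expr1n mul1r mulr1.
  have -> : 2 * (- (a + 1) / (2 * b)) * b = - (a + 1) by field; rewrite b0.
  by lra.
have cp : 0 < c by rewrite lt_neqAle eq_sym c00.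
have := key c (- b).
have -> : c ^+ 2 * a + 2 * c * - b * b + (- b) ^+ 2 * c = c * (a * c - b ^+ 2) by ring.
by rewrite pmulr_rge0// subr_ge0.
Qed.

Lemma cauchy_schwarz_norm f g : measurable_fun setT f -> measurable_fun setT g ->
  intg (fun x => f x ^+ 2) -> intg (fun x => g x ^+ 2) ->
  (\int[P]_x `|f x * g x|) ^+ 2 <= (\int[P]_x (f x ^+ 2)) * \int[P]_x (g x ^+ 2).
Proof.
move=> mf mg if2 ig2.
have := @cauchy_schwarz (fun x => `|f x|) (fun x => `|g x|).
have e h : (fun x : T => `|h x| ^+ 2) = (fun x => h x ^+ 2 : R).
  by apply/funext => x; rewrite real_normK// num_real.
have eM : (fun x => `|f x| * `|g x|) = (fun x => `|f x * g x|).
  by apply/funext => x; rewrite normrM.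
rewrite !e eM; apply => //; exact: measurableT_comp.
Qed.

(** Centred Gaussian laws, possibly degenerate, described by moments alone; centring is the case
    [n = 1]. *)
Definition gaussian V := all_moments P V /\
  forall n, \int[P]_x (V x ^+ n) = gauss_moment (\int[P]_x (V x ^+ 2)) n.

Section limit.
Variables (V_ : nat -> T -> R) (V : T -> R).
Hypothesis gV_ : forall n, gaussian (V_ n).
Hypothesis mV : measurable_fun setT V.
Let delta n := \int[P]_x ((V x - V_ n x) ^+ 2).
Hypothesis idelta : forall n, intg (fun x => (V x - V_ n x) ^+ 2).
Hypothesis delta0 : delta n @[n --> \oo] --> 0.

Let amV_ n : all_moments P (V_ n). Proof. by have [] := gV_ n. Qed.

Let mV_ n : measurable_fun setT (V_ n). Proof. by have [] := amV_ n. Qed.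

Let mdV n : measurable_fun setT (fun x => V x - V_ n x).
Proof. exact: measurable_funB. Qed.

Let iV2 : intg (fun x => V x ^+ 2).
Proof.
have [_ h] := amV_ 0.
apply: (intg_le _ (intgZ 2 (intgD (h 2%N) (idelta 0)))).
  exact: measurable_funX.
move=> x; rewrite ger0_norm ?sqr_ge0//.
have := sqr_ge0 (V x - 2 * V_ 0 x); nra.
Qed.

Let bound : exists2 K : R, 0 <= K & forall n, \int[P]_x (V_ n x ^+ 2) <= K.
Proof.
have [M [_ hM]] := cvg_seq_bounded (cvgP _ delta0).
have dM n : delta n <= `|M| + 1.
  have := hM (`|M| + 1); rewrite ltr_pwDr ?ler_norm// => /(_ isT n I).
  exact: le_trans (ler_norm _).
exists (2 * (\int[P]_x (V x ^+ 2) + (`|M| + 1))).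
  have : 0 <= \int[P]_x (V x ^+ 2) by apply: Rintegral_ge0 => x _; exact: sqr_ge0.
  by move=> ?; rewrite mulr_ge0 ?addr_ge0.
move=> n; have [_ h] := amV_ n.
apply: (@le_trans _ _ (2 * (\int[P]_x (V x ^+ 2) + delta n))); last first.
  by rewrite ler_wpM2l// lerD2l.
rewrite -(RintegralD measurableT iV2 (idelta n)).
rewrite -(RintegralZl 2 measurableT (intgD iV2 (idelta n))).
apply: (le_Rintegral measurableT (h 2%N) (intgZ 2 (intgD iV2 (idelta n)))).
by move=> x _; have := sqr_ge0 (2 * V x - V_ n x); nra.
Qed.

(** Gaussian moments of each order are controlled by the variance, so the bound on the variances
    suffices. It plays the role of uniform integrability. *)
Let even_bound k : exists2 C : R, 0 <= C & forall n, \int[P]_x (V_ n x ^+ k) <= C.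
Proof.
have [K K0 hK] := bound; exists (gauss_moment K k).
  suff /andP[] : 0 <= gauss_moment K k <= gauss_moment K k by [].
  by apply: gauss_moment_le; rewrite K0 lexx.
move=> n; have [_ ->] := gV_ n.
suff /andP[] : 0 <= gauss_moment (\int[P]_x (V_ n x ^+ 2)) k <= gauss_moment K k by [].
apply: gauss_moment_le; rewrite hK andbT; apply: Rintegral_ge0 => x _; exact: sqr_ge0.
Qed.

(* The truncated powers are Lipschitz, hence pass to the L^2 limit. *)
Let truncated_bound k C : (forall n, \int[P]_x (V_ n x ^+ (k.+1 * 2)) <= C) ->
  forall M : nat, (\int[P]_x ((Num.min `|V x| M%:R) ^+ (k.+1 * 2))%:E <= C%:E)%E.
Proof.
move=> hC M; set m := (k.+1 * 2)%N; pose h (x : R) : R := (Num.min `|x| M%:R) ^+ m.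
have mh W : measurable_fun setT W -> measurable_fun setT (h \o W).
  move=> mW; apply: measurable_funX; apply: measurable_minr => //.
  exact: measurableT_comp.
have h0 x : 0 <= h x by rewrite exprn_ge0// le_min normr_ge0 ler0n.
have hM x : h x <= M%:R ^+ m.
  by rewrite lerXn2r ?nnegrE ?le_min ?normr_ge0 ?ler0n// ge_min lexx orbT.
have ih W : measurable_fun setT W -> intg (h \o W).
  move=> mW; apply: (intg_le _ (intg_cst P (M%:R ^+ m))); first exact: mh.
  by move=> x /=; rewrite ger0_norm.
rewrite -(EFin_Rintegral measurableT (ih V mV)) lee_fin.
(* If the bound fails, the integral of [h (V x)] minus [C] is positive, so that the linear estimate
   [h1] may be squared and passed to the limit. *)
rewrite leNgt; apply/negP => CD.
pose L : R := m%:R * M%:R ^+ m.-1.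
have L0 : 0 <= L by rewrite mulr_ge0// exprn_ge0.
have lip x y : h x <= h y + L * `|x - y|.
  rewrite -lerBlDl; apply: (le_trans (ler_norm _)).
  apply: (le_trans (@exprn_lipschitz _ M%:R _ _ _ _ _)).
  - by rewrite le_min normr_ge0 ler0n ge_min lexx orbT.
  - by rewrite le_min normr_ge0 ler0n ge_min lexx orbT.
  rewrite ler_wpM2l//.
  apply: le_trans (ler_dist_dist x y).
  move: `|x| `|y| (M%:R : R) => a b c.
  have := ler_norm (a - b); have := ler_norm (- (a - b)); rewrite normrN.
  have [ac|ac] := leP a c; have [bc|bc] := leP b c; rewrite ler_norml => *;
    by apply/andP; split; lra.
have id n : intg (fun x => V x - V_ n x).
  apply: (intg_le _ (intgD (intg_cst P 1) (idelta n))) => //.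
  move=> x /=; move: (V x - V_ n x) => y; rewrite ler_norml.
  by have := sqr_ge0 (y - 1); have := sqr_ge0 (y + 1) => *; apply/andP; split; lra.
have hn n : (\int[P]_x h (V x) - C) ^+ 2 <= L ^+ 2 * delta n.
  have h1 : \int[P]_x h (V x) - C <= L * \int[P]_x `|V x - V_ n x|.
    rewrite lerBlDl.
    apply: (@le_trans _ _ (\int[P]_x (V_ n x ^+ m) + L * \int[P]_x `|V x - V_ n x|)).
      have [_ /(_ m) im] := amV_ n.
      rewrite -(RintegralZl L measurableT (intg_norm (id n))).
      rewrite -(RintegralD measurableT im (intgZ L (intg_norm (id n)))).
      apply: (le_Rintegral measurableT (ih V mV)
        (intgD im (intgZ L (intg_norm (id n))))).
      move=> x _; apply: (le_trans (lip _ (V_ n x))).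
      rewrite lerD2r /h.
      have -> : V_ n x ^+ m = `|V_ n x| ^+ m.
        by rewrite /m mulnC !exprM real_normK ?num_real.
      by rewrite lerXn2r ?nnegrE ?le_min ?normr_ge0 ?ler0n// ge_min lexx.
    by rewrite lerD2r.
  have h2 : (\int[P]_x `|V x - V_ n x|) ^+ 2 <= delta n.
    have := @cauchy_schwarz_norm (fun x => V x - V_ n x) (cst 1).
    under eq_Rintegral do rewrite mulr1.
    have e : \int[P]_x (cst 1 x ^+ 2) = 1 :> R.
      by under eq_Rintegral do rewrite expr1n; exact: Rintegral_prob_cst.
    by rewrite e mulr1; apply => //; exact: (intg_cst P (1 ^+ 2)).
  apply: (@le_trans _ _ ((L * \int[P]_x `|V x - V_ n x|) ^+ 2)).
    rewrite lerXn2r ?nnegrE//; first by rewrite subr_ge0 ltW.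
    by rewrite mulr_ge0//; apply: Rintegral_ge0.
  by rewrite exprMn ler_wpM2l// sqr_ge0.
have : (\int[P]_x h (V x) - C) ^+ 2 <= 0.
  have Ld : L ^+ 2 * delta n @[n --> \oo] --> 0.
    by rewrite -[X in _ --> X](mulr0 (L ^+ 2)); exact: cvgMr.
  by apply: (cvgr_to_ge Ld); exact: nearW.
by rewrite leNgt exprn_gt0// subr_gt0.
Qed.

(** The bound on the truncated moments does not depend on the level [M], so monotone convergence
    removes the truncation. *)
Let even_moment_lty k : intg (fun x => V x ^+ (k.+1 * 2)).
Proof.
have [C C0 hC] := even_bound (k.+1 * 2).
have mV2 : measurable_fun setT (fun x => V x ^+ (k.+1 * 2)) by exact: measurable_funX.
apply/integrableP; split; first exact/measurable_EFinP.
under eq_integral => x _.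
  rewrite /= ger0_norm; last by rewrite mulnC exprM exprn_ge0// sqr_ge0.
  over.
apply: (@le_lt_trans _ _ C%:E); last exact: ltry.
pose g M x := ((Num.min `|V x| M%:R) ^+ (k.+1 * 2))%:E.
have cg x : g M x @[M --> \oo] --> (V x ^+ (k.+1 * 2))%:E.
  apply: cvg_near_cst; near=> M.
  rewrite /g minEle ifT; last by near: M; exact: nbhs_infty_ger.
  by rewrite mulnC !exprM real_normK// num_real.
rewrite (eq_integral (fun x => limn (g^~ x))); last first.
  by move=> x _; apply/esym; apply: cvg_lim; [by []|exact: cg].
rewrite monotone_convergence//.
- apply: lime_le; last first.
    by apply: nearW => M; exact: truncated_bound hC M.
  apply: ereal_nondecreasing_is_cvgn => m n mn; apply: ge0_le_integral => //.
  + by move=> x _; rewrite lee_fin exprn_ge0// le_min normr_ge0 ler0n.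
  + apply/measurable_EFinP; apply: measurable_funX; apply: measurable_minr => //.
    exact: measurableT_comp.
  + apply/measurable_EFinP; apply: measurable_funX; apply: measurable_minr => //.
    exact: measurableT_comp.
  + move=> x _; rewrite lee_fin lerXn2r ?nnegrE ?le_min ?normr_ge0 ?ler0n//.
    by rewrite ge_min lexx/= ge_min ler_nat mn orbT.
- move=> M; apply/measurable_EFinP; apply: measurable_funX; apply: measurable_minr => //.
  exact: measurableT_comp.
- by move=> M x _; rewrite lee_fin exprn_ge0// le_min normr_ge0 ler0n.
- move=> x _ m n mn; rewrite lee_fin lerXn2r ?nnegrE ?le_min ?normr_ge0 ?ler0n//.
  by rewrite ge_min lexx/= ge_min ler_nat mn orbT.
Unshelve. all: by end_near. Qed.

Lemma all_moments_limit : all_moments P V.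
Proof.
split=> // -[|n]; first by apply: eq_integrable (intg_cst P 1).
apply: (intg_le _ (intgD (intg_cst P 1) (even_moment_lty n))).
  exact: measurable_funX.
move=> x /=; rewrite exprM; set y := V x ^+ n.+1.
by rewrite ler_norml; apply/andP; split; nra.
Qed.

(** A difference of powers is at most $(n+1)|V-V_k|(|V|^n+|V_k|^n)$; by Cauchy-Schwarz the first
    factor gives [delta k], and the second is bounded uniformly in [k]. *)
Lemma cvg_moment_limit n : \int[P]_x (V_ k x ^+ n) @[k --> \oo] --> \int[P]_x (V x ^+ n).
Proof.
case: n => [|n]; first by under eq_cvg do under eq_Rintegral do rewrite expr0; exact: cvg_cst.
have [_ amV] := all_moments_limit.
have [C C0 hC] := even_bound (n * 2).
(* The factor $(n+1)^2$ comes from the difference of powers, the $2$ from $(a+b)^2\le2(a^2+b^2)$,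
   and [C] bounds the moments of order [n * 2] of all [V_ k]. *)
pose D := n.+1%:R ^+ 2 * (2 * (C + \int[P]_x (V x ^+ (n * 2)))).
have hD k : (\int[P]_x (V x ^+ n.+1) - \int[P]_x (V_ k x ^+ n.+1)) ^+ 2 <= D * delta k.
  have [_ amk] := amV_ k.
  pose W x := `|V x| ^+ n + `|V_ k x| ^+ n.
  have mW : measurable_fun setT W.
    by apply: measurable_funD; apply: measurable_funX; exact: measurableT_comp.
  have WE x : W x ^+ 2 <= 2 * (V x ^+ (n * 2) + V_ k x ^+ (n * 2)).
    rewrite !exprM /W -(real_normK (num_real (V x ^+ n))) -(real_normK (num_real (V_ k x ^+ n))).
    by rewrite !normrX; set a := _ ^+ n; set b := _ ^+ n; have := sqr_ge0 (a - b); nra.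
  have i2 := intgZ 2 (intgD (amV (n * 2)%N) (amk (n * 2)%N)).
  have iW2 : intg (fun x => W x ^+ 2).
    apply: (intg_le _ i2); first exact: measurable_funX.
    by move=> x; rewrite ger0_norm ?sqr_ge0.
  have W2 : \int[P]_x (W x ^+ 2) <= 2 * (C + \int[P]_x (V x ^+ (n * 2))).
    apply: (@le_trans _ _ (\int[P]_x (2 * (V x ^+ (n * 2) + V_ k x ^+ (n * 2))))).
      by apply: (le_Rintegral measurableT iW2 i2) => x _; exact: WE.
    rewrite (RintegralZl 2 measurableT (intgD (amV (n * 2)%N) (amk (n * 2)%N))).
    rewrite (RintegralD measurableT (amV (n * 2)%N) (amk (n * 2)%N)).
    by rewrite ler_wpM2l// addrC lerD2r.
  have idW := intgM (mdV k) mW (idelta k) iW2.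
  have h1 : `|\int[P]_x (V x ^+ n.+1) - \int[P]_x (V_ k x ^+ n.+1)| <=
      n.+1%:R * \int[P]_x `|(V x - V_ k x) * W x|.
    rewrite -(RintegralB measurableT (amV n.+1) (amk n.+1)).
    apply: (le_trans (le_normr_Rintegral measurableT (intgB (amV n.+1) (amk n.+1)))).
    rewrite -(RintegralZl _ measurableT (intg_norm idW)).
    apply: (le_Rintegral measurableT (intg_norm (intgB (amV n.+1) (amk n.+1)))
      (intgZ _ (intg_norm idW))) => x _.
    apply: (le_trans (norm_exprnB_le _ _ _)).
    by rewrite normrM [`|W x|]ger0_norm// addr_ge0// exprn_ge0.
  rewrite -[leLHS]real_normK ?num_real//.
  apply: (@le_trans _ _ ((n.+1%:R * \int[P]_x `|(V x - V_ k x) * W x|) ^+ 2)).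
    by rewrite lerXn2r ?nnegrE// mulr_ge0//; apply: Rintegral_ge0.
  rewrite exprMn /D -mulrA ler_wpM2l ?sqr_ge0//.
  apply: (le_trans (cauchy_schwarz_norm (mdV k) mW (idelta k) iW2)).
  by rewrite mulrC ler_wpM2r//; apply: Rintegral_ge0 => x _; exact: sqr_ge0.
apply/cvgrPdist_lt => e e0.
have : D * delta k @[k --> \oo] --> 0.
  by rewrite -[X in _ --> X](mulr0 D); apply: cvgMr.
move=> /cvgrPdist_lt /(_ (e ^+ 2)); rewrite exprn_gt0// => /(_ isT).
apply: filterS => k; rewrite sub0r normrN => h.
rewrite -(@ltr_pXn2r _ 2)// ?nnegrE ?ltW// real_normK ?num_real//.
by rewrite (le_lt_trans (hD k))// (le_lt_trans (ler_norm _)).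
Qed.

Lemma gaussian_limit : gaussian V.
Proof.
split; first exact: all_moments_limit.
move=> n; have e k : \int[P]_x (V_ k x ^+ n) = gauss_moment (\int[P]_x (V_ k x ^+ 2)) n.
  by have [_ ->] := gV_ k.
have h1 := @cvg_moment_limit n; rewrite (funext e) in h1.
exact: (cvg_unique _ h1 (@cvgn_gauss_moment R _ _ n (@cvg_moment_limit 2))).
Qed.

End limit.

End gaussian.

(** * Hermite polynomials and the bivariate Stein identity *)

(** The recursion $H_{n+1}=xH_n-H_n'$ has the shape of Stein's identity, which is how it is used
    below. *)
Fixpoint hermite_poly {R : realType} (q : nat) : {poly R} :=
  if q is n.+1 then 'X * hermite_poly n - (hermite_poly n)^`() else 1.

Lemma hermiteE {R : realType} q (x : R) : hermite q x = (hermite_poly q).[x].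
Proof.
pose g (y : R) := expR (- (y ^+ 2 / 2)).
have dg (y : R) : is_derive y 1 g (- y * g y).
  apply: is_derive_eq; rewrite /GRing.scale/= !mulr0 add0r mulr1.
  by rewrite -mulr2n -(mulr_natl y) mulKf ?pnatr_eq0// mulrC.
have -> : hermite q x = (-1) ^+ q * expR (x ^+ 2 / 2) * derive1n q g x by [].
have -> : derive1n q g = (fun y => (-1) ^+ q * (hermite_poly q).[y] * g y).
  elim: q => [|q IH]; first by apply/funext => y; rewrite derive1n0 hornerC expr0 !mul1r.
  apply/funext => y; rewrite derive1nS IH derive1E.
  apply: derive_val.
  have h := is_derive_poly (hermite_poly q) y.
  apply: is_derive_eq; rewrite [(hermite_poly q.+1).[y]]hornerD hornerN hornerM hornerX.
  by rewrite /GRing.scale/= exprS; ring.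
rewrite mulrACA [X in X * _]mulrA -expr2 -exprM mulnC exprM sqrrN !expr1n mul1r.
by rewrite /g -expRD subrr expR0 mulr1.
Qed.

Lemma poly_ext {R : realType} (p q : {poly R}) : (forall x, p.[x] = q.[x]) -> p = q.
Proof.
move=> pq; apply/eqP; rewrite -subr_eq0; apply/negP => /negP pq0.
pose s := [seq i%:R : R | i <- iota 0 (size (p - q))].
have := @max_poly_roots _ (p - q) s pq0.
rewrite size_map size_iota ltnn map_inj_uniq ?iota_uniq; last first.
  by move=> i j /eqP; rewrite eqr_nat => /eqP.
move=> h; have /h : all (root (p - q)) s.
  by apply/allP => x _; rewrite rootE !hornerE pq subrr.
by move=> /(_ isT).
Qed.

Section bivariate.
Context {d : measure_display} {T : measurableType d} {R : realType}.
Variable P : probability T R.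
Variables A B : T -> R.
Hypothesis amA : all_moments P A.
Hypothesis amB : all_moments P B.
Hypothesis gAB : forall s : R, gaussian P (fun x => s * A x + B x).

Local Notation intg f := (P.-integrable [set: T] (EFin \o f)).

Let M m n := \int[P]_x (A x ^+ m * B x ^+ n).

Let amAB m n : all_moments P (fun x => A x ^+ m * B x ^+ n).
Proof. by apply: all_momentsM; exact: all_momentsX. Qed.

Let iAB m n : intg (fun x => A x ^+ m * B x ^+ n).
Proof. exact/all_moments_intg. Qed.

(** Packs the mixed moments of total degree [N] into the moment of order [N] of [s * A + B], seen as
    a polynomial in [s]. *)
Let F N : {poly R} := \poly_(j < N.+1) ('C(N, j)%:R * M j (N - j)).

Let FE N s : (F N).[s] = \int[P]_x ((s * A x + B x) ^+ N).
Proof.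
rewrite horner_poly.
have e x : (s * A x + B x) ^+ N =
    \sum_(j < N.+1) ('C(N, j)%:R * s ^+ j) * (A x ^+ j * B x ^+ (N - j)).
  rewrite addrC exprDn; apply: eq_bigr => j _.
  by rewrite exprMn -[LHS]mulr_natl; ring.
under [RHS]eq_Rintegral do rewrite e.
rewrite Rintegral_sum; last by move=> j; exact: intgZ.
by apply: eq_bigr => j _; rewrite RintegralZl// /M; ring.
Qed.

Let Q : {poly R} := M 2 0 *: 'X^2 + (2 * M 1 1) *: 'X + (M 0 2)%:P.

Let QE s : Q.[s] = \int[P]_x ((s * A x + B x) ^+ 2).
Proof.
rewrite -FE horner_poly !big_ord_recr big_ord0/= !hornerE.
by rewrite /Q ?hornerE/= ?bin0 ?bin1 ?binn; ring.
Qed.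

(** The moment recursion of a Gaussian variable, with [Q] the variance along the pencil. As it holds
    for every real [s], it holds between polynomials. *)
Let FSS N : F N.+2 = N.+1%:R *: (Q * F N).
Proof.
apply: poly_ext => s; rewrite hornerZ hornerM !FE QE.
have [_ h] := gAB s; rewrite (h N.+2) (h N) gauss_momentSS.
by rewrite mulrA.
Qed.

Let F1 : F 1 = 0.
Proof.
apply: poly_ext => s; rewrite FE horner0.
by have [_ /(_ 1%N)] := gAB s.
Qed.

(** Formally $F_N$ is a multiple of $Q^{N/2}$, so that $2F_N'=N(N-1)Q'F_{N-2}$. The induction in
    [key] obtains this without half-integer powers. *)
Let dF N : (F N.+2)^`() = (N.+2%:R * N.+1%:R) *: ((M 2 0 *: 'X + (M 1 1)%:P) * F N).
Proof.
have dQ : Q^`() = 2%:R *: (M 2 0 *: 'X + (M 1 1)%:P).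
  rewrite /Q !derivD !derivZ derivXn derivX derivC addr0.
  by apply: poly_ext => s; rewrite !hornerE; ring.
(* At [k = 0] the truncated predecessor is harmless, since the scalar factor is zero. *)
have key : forall k, (F k.+1)^`() *+ 2 = (k.+1%:R * k%:R) *: (Q^`() * F k.-1).
  elim/gauss_moment_ind => [||k IH].
  - by rewrite F1 derivC mul0rn mulr0 scale0r.
  - rewrite FSS derivZ derivM /=.
    have -> : F 0 = 1.
      apply: poly_ext => s; rewrite FE hornerC.
      by under eq_Rintegral do rewrite expr0; exact: Rintegral_prob_cst.
    by rewrite derivC mulr0 addr0 !mulr1 scale1r -scaler_nat.
  - rewrite FSS derivZ derivM scalerMnr mulrnDl -[X in _ + X]mulrnAr IH.
    have e : Q * ((k.+1%:R * k%:R) *: (Q^`() * F k.-1)) = k.+1%:R *: (Q^`() * F k.+1).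
      case: k {IH} => [|k]; first by rewrite F1 mulr0 scale0r !mulr0 scaler0.
      rewrite [F k.+2]FSS -!scalerAr !scalerA mulrCA -scalerA.
      by rewrite scalerAr.
    rewrite e -[(Q^`() * _) *+ 2]scaler_nat -scalerDl scalerA; congr (_ *: _).
    by rewrite -[k.+3%:R]natr1 -[k.+2%:R]natr1; ring.
apply: (@scalerI _ _ (2%:R : R)); first by rewrite pnatr_eq0.
rewrite scaler_nat key dQ /= !scalerA -scalerAl scalerA; congr (_ *: _).
by ring.
Qed.

Let coefF N j : (F N)`_j = 'C(N, j)%:R * M j (N - j).
Proof.
by rewrite coef_poly; case: ltnP => // Nj; rewrite bin_small// mul0r.
Qed.

(** Comparison of the coefficients of $s^m$ in [dF]. The truncated predecessors are multiplied by
    [m] or [n], which vanish where truncation occurs. *)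
Lemma gaussian_stein m n : M m.+1 n =
  m%:R * M 2 0 * M m.-1 n + n%:R * M 1 1 * M m n.-1.
Proof.
(* For [m = n = 0] the claim is that [A] is centred, which is read off [F 1 = 0]; the choice of [N]
   below needs a positive total degree. *)
have [mn|mn] := posnP (m + n).
  move/eqP: mn; rewrite addn_eq0 => /andP[/eqP -> /eqP ->].
  have := coefF 1 1; rewrite F1 coef0 binn mul1r subnn => <-.
  by rewrite !mul0r addr0.
pose N := (m + n).-1.
have NE : N.+1 = (m + n)%N by rewrite prednK.
have mN : (m <= N.+1)%N by rewrite NE leq_addr.
have en : (N.+2 - m.+1 = n)%N by rewrite subSS NE addKn.
have h : N.+2%:R * 'C(N.+1, m)%:R * M m.+1 n = N.+2%:R * N.+1%:R *
    (M 2 0 * (if m == 0 then 0 else (F N)`_m.-1) +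
     M 1 1 * ('C(N, m)%:R * M m (N - m))).
  have := congr1 (fun p : {poly R} => p`_m) (dF N).
  rewrite coef_deriv coefZ [(_ + _) * F N]mulrDl coefD coefCM -[_ *: 'X * F N]scalerAl.
  rewrite coefZ coefXM (coefF N m) (coefF N.+2 m.+1) en => <-.
  by rewrite -[RHS]mulr_natl mulrA -!natrM -mul_bin_diag.
have c0 : 'C(N.+1, m)%:R != 0 :> R by rewrite pnatr_eq0 -lt0n bin_gt0.
have N0 : N.+2%:R != 0 :> R by rewrite pnatr_eq0.
have h1 : (N.+1%:R : R) * ((if m == 0 then 0 else (F N)`_m.-1)) =
    'C(N.+1, m)%:R * (m%:R * M m.-1 n).
  case: (posnP m) => [m0|m0]; first by rewrite m0 mul0r !mulr0.
  rewrite coefF [LHS]mulrA -natrM.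
  have := mul_bin_diag N.+1 m.-1; rewrite /= prednK// => ->.
  have -> : (N - m.-1 = n)%N by rewrite -subSS prednK// NE addKn.
  by rewrite natrM; ring.
have h2 : (N.+1%:R : R) * ('C(N, m)%:R * M m (N - m)) =
    'C(N.+1, m)%:R * (n%:R * M m n.-1).
  rewrite [LHS]mulrA -natrM (mul_bin_down N.+1 m) NE addKn.
  have -> : (N - m = n.-1)%N by rewrite /N -subn1 subnAC addKn subn1.
  by rewrite natrM; ring.
apply: (mulfI N0); apply: (mulfI c0).
rewrite mulrCA mulrA h; set i1 := (if _ then _ else _) in h1 *.
transitivity (N.+2%:R * (M 2 0 * (N.+1%:R * i1) +
  M 1 1 * (N.+1%:R * ('C(N, m)%:R * M m (N - m))))); first by ring.
by rewrite h1 h2; ring.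
Qed.

Lemma all_moments_horner (p : {poly R}) n : all_moments P (fun x => p.[A x] * B x ^+ n).
Proof.
apply: all_momentsM; last exact: all_momentsX.
under eq_fun do rewrite horner_coef.
by apply: all_moments_sum => i; apply: all_momentsZ; exact: all_momentsX.
Qed.

Let E (p : {poly R}) n := \int[P]_x (p.[A x] * B x ^+ n).

Let EE (p : {poly R}) n k : (size p <= k)%N -> E p n = \sum_(i < k) p`_i * M i n.
Proof.
move=> pk; rewrite /E.
under eq_Rintegral do rewrite (horner_coef_wide _ pk) mulr_suml.
under eq_Rintegral do under eq_bigr do rewrite -mulrA.
rewrite Rintegral_sum; last by move=> i; exact: intgZ.
by apply: eq_bigr => i _; rewrite RintegralZl.
Qed.

Lemma gaussian_stein_poly (p : {poly R}) n :
  E ('X * p) n = M 2 0 * E p^`() n + n%:R * M 1 1 * E p n.-1.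
Proof.
have [p0|p0] := posnP (size p).
  move/eqP: p0; rewrite size_poly_eq0 => /eqP ->.
  by rewrite deriv0 mulr0 /E; under eq_Rintegral do rewrite horner0 mul0r;
    under [X in _ = _ + _ * X]eq_Rintegral do rewrite horner0 mul0r;
    rewrite (Rintegral_prob_cst P 0) !mulr0 addr0.
pose k := (size p).-1.
have kE : size p = k.+1 by rewrite prednK.
rewrite (@EE _ n k.+2); last first.
  by rewrite (leq_trans (size_polyMleq _ _))// size_polyX kE.
rewrite (@EE p^`() n k); last first.
  by rewrite -ltnS -kE lt_size_deriv// -size_poly_gt0.
rewrite (@EE p n.-1 k.+1); last by rewrite kE.
rewrite big_ord_recl coefXM/= mul0r add0r.
under eq_bigr do rewrite coefXM/= gaussian_stein mulrDr.
rewrite big_split/=; congr (_ + _); last first.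
  by rewrite mulr_sumr; apply: eq_bigr => i _; ring.
rewrite big_ord_recl/= !mul0r mulr0 add0r mulr_sumr; apply: eq_bigr => i _.
by rewrite coef_deriv /bump/= add1n -[X in _ = _ * (X * _)]mulr_natl; ring.
Qed.

(** Stein's identity for $AH_q(A)B^{q+1}$ produces a term with $H_q'$, which the Hermite recursion
    cancels because $E[A^2]=1$; what remains is $(q+1)E[AB]$ times the previous case. *)
Lemma gaussian_hermite q : \int[P]_x (A x ^+ 2) = 1 ->
  \int[P]_x ((hermite_poly q).[A x] * B x ^+ q) = q`!%:R * (\int[P]_x (A x * B x)) ^+ q.
Proof.
move=> A1.
have M20 : M 2 0 = 1 by rewrite -A1; apply: eq_Rintegral => x _; rewrite mulr1.
have M11 : M 1 1 = \int[P]_x (A x * B x) by [].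
elim: q => [|q IH].
  under eq_Rintegral do rewrite hornerC mul1r.
  by rewrite expr0 mulr1; exact: Rintegral_prob_cst.
have := gaussian_stein_poly (hermite_poly q) q.+1; rewrite M20 mul1r /= -/(E _ _).
have -> : E (hermite_poly q) q = q`!%:R * (\int[P]_x (A x * B x)) ^+ q by exact: IH.
rewrite M11 => h.
transitivity (E ('X * hermite_poly q) q.+1 - E (hermite_poly q)^`() q.+1).
  rewrite /E -(RintegralB measurableT (all_moments_intg (all_moments_horner _ _))
    (all_moments_intg (all_moments_horner _ _))).
  by apply: eq_Rintegral => x _; rewrite -mulrBl !hornerE.
by rewrite h factS natrM exprS; ring.
Qed.

End bivariate.

(** * Conditional expectation *)

Section conditional_expectation.
Context {d : measure_display} {T : measurableType d} {R : realType}.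
Variables (P : probability T R) (C : set (set T)).
Hypothesis mC : C `<=` measurable.
Implicit Types Y Z W : T -> R.

Local Notation intg f := (P.-integrable [set: T] (EFin \o f)).
Local Notation T' := (g_sigma_algebraType C).

Let sub_measurable A : <<s C >> A -> measurable A.
Proof. by apply: smallest_sub => //; exact: sigma_algebra_measurable. Qed.

Let mid : measurable_fun setT (id : T -> T').
Proof. by move=> _ B mB; rewrite setTI; exact: sub_measurable. Qed.

(** The Radon-Nikodym derivative of $A\mapsto\int_AZ\,dP$ with respect to [P], both restricted to
    the generated sigma-algebra. Restriction is expressed as push-forward along the identity into
    [T']. *)
Lemma ex_cond_exp Z : intg Z -> exists Y, is_cond_exp P <<s C >> Z Y.
Proof.
move=> iZ.
pose f : T -> T' := id.
have mf : measurable_fun setT f := mid.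
pose nu := induced_charge iZ.
unshelve epose (nu' := (pushforward nu f : {charge set T' -> \bar R})); first exact: mf.
pose X : {mfun T >-> T'} :=
  MeasurableFun.Pack (MeasurableFun.Class (isMeasurableFun.Build _ _ _ _ _ mf)).
pose mu : probability T' R := distribution P X.
have numu : nu' `<< mu.
  apply/null_content_dominatesP => A mA muA0.
  rewrite /nu' /nu /= /pushforward /induced_charge.
  apply: null_set_integral => //; first exact: sub_measurable.
  by apply: measurable_funTS; apply: measurable_int iZ.
pose g := Radon_Nikodym nu' mu.
have gfin x : g x \is a fin_num by exact: Radon_Nikodym_fin_num.
have ig : mu.-integrable setT g by exact: Radon_Nikodym_integrable.
have mg : measurable_fun setT g by exact: measurable_int ig.
have iPg : P.-integrable setT (g \o f).
  apply/integrableP; split; first exact: measurableT_comp.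
  move/integrableP : ig => [_]; rewrite ge0_integral_distribution//.
  exact: measurableT_comp.
exists (fun x => fine (g x)); split.
- move=> B mB.
  have mfg : measurable_fun setT (fine \o g) by exact: measurableT_comp.
  by have := mfg measurableT B mB; rewrite setTI.
- apply: eq_integrable iPg => // x _.
  by rewrite /= fineK.
- move=> A GA.
  have := Radon_Nikodym_integral numu GA.
  have mA := sub_measurable GA.
  rewrite (@integral_pushforward _ _ _ _ R f mf P A g mg)//; last first.
    by apply: integrableS iPg.
  move=> h; rewrite [RHS](_ : _ = nu' A)// h.
  by apply: eq_integral => x _; rewrite /= fineK.
Qed.

(** Hence the default value in [cond_exp] never occurs for an integrable variable. *)
Lemma cond_expP Z : intg Z -> is_cond_exp P <<s C >> Z (cond_exp P <<s C >> Z).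
Proof.
move=> iZ; rewrite /cond_exp; case: xgetP => [Y _ //|none].
by have [Y /none] := ex_cond_exp iZ.
Qed.

(** The definition tests against events only. An unbounded [W] is reached as a function of the
    identity into [T'], over whose events [Y] and [Z] have equal integrals. *)
Lemma cond_exp_test Z Y W : intg Z -> is_cond_exp P <<s C >> Z Y ->
  (forall B : set R, measurable B -> <<s C >> (W @^-1` B)) ->
  intg (fun x => W x * Y x) -> intg (fun x => W x * Z x) ->
  \int[P]_x (W x * Y x) = \int[P]_x (W x * Z x).
Proof.
move=> iZ [_ iY h] mW iWY iWZ.
have mW' : measurable_fun [set: T'] (W : T' -> R).
  by move=> _ B mB; rewrite setTI; exact: mW.
apply: (@Rintegral_comp_weight_eq _ _ _ P _ T' (id : T -> T') Y Z W mid) => //.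
by move=> B mB; rewrite /Rintegral h.
Qed.

End conditional_expectation.

(** * Mean-square limits *)

Section L2_limits.
Context {d : measure_display} {T : measurableType d} {R : realType}.
Variable P : probability T R.
Implicit Types Z V W : T -> R.

Local Notation intg f := (P.-integrable [set: T] (EFin \o f)).

Lemma l2norm_lty Z : measurable_fun setT Z -> (l2norm P Z < +oo)%E ->
  intg (fun x => Z x ^+ 2) /\ l2norm P Z = (Num.sqrt (\int[P]_x (Z x ^+ 2)))%:E.
Proof.
move=> mZ; rewrite /l2norm unlock/=.
have -> : (\int[P]_x `|(Z x)%:E| `^ 2 = \int[P]_x (Z x ^+ 2)%:E)%E.
  apply: eq_integral => x _.
  by rewrite abse_EFin poweR_EFin powR_mulrn// real_normK// num_real.
have I0 : (0 <= \int[P]_x (Z x ^+ 2)%:E)%E.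
  by apply: integral_ge0 => x _; rewrite lee_fin sqr_ge0.
rewrite poweR12_sqrt// => h.
have fI : (\int[P]_x (Z x ^+ 2)%:E < +oo)%E.
  by move: h I0; case: (\int[P]_x _)%E => //= *; rewrite ltry.
split.
  apply/integrableP; split; first exact/measurable_EFinP/measurable_funX.
  by under eq_integral do rewrite /= ger0_norm ?sqr_ge0//.
by rewrite /Rintegral; move: fI I0 h; case: (\int[P]_x _)%E.
Qed.

(** Convergence in the extended reals allows finitely many infinite norms, hence the integrability
    for large [n] only. *)
Lemma l2norm_cvg0 (Z_ : nat -> T -> R) : (forall n, measurable_fun setT (Z_ n)) ->
  l2norm P (Z_ n) @[n --> \oo] --> 0%E ->
  (\forall n \near \oo, intg (fun x => Z_ n x ^+ 2)) /\
  \int[P]_x (Z_ n x ^+ 2) @[n --> \oo] --> 0.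
Proof.
move=> mZ Z0.
have near_fin : \forall n \near \oo, (l2norm P (Z_ n) < +oo)%E.
  have /fine_cvgP[h _] := Z0.
  by apply: filterS h => n; rewrite fin_numE => /andP[_]; rewrite ltey.
split; first by apply: filterS near_fin => n /(l2norm_lty (mZ n))[].
have /fine_cvgP[_ h] := Z0.
have h2 : (fine (l2norm P (Z_ n))) * (fine (l2norm P (Z_ n))) @[n --> \oo] --> (0 : R).
  by rewrite -[X in _ --> X](mulr0 (0 : R)); exact: (cvgM h h).
move: h2; apply: cvg_trans; apply: near_eq_cvg.
apply: filterS near_fin => n /(l2norm_lty (mZ n))[_ ->] /=.
by rewrite -expr2 sqr_sqrtr//; apply: Rintegral_ge0 => x _; exact: sqr_ge0.
Qed.

Definition L2_cvg (V_ : nat -> T -> R) V :=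
  [/\ (forall n, all_moments P (V_ n)), measurable_fun setT V,
      (forall n, intg (fun x => (V x - V_ n x) ^+ 2)) &
      \int[P]_x ((V x - V_ n x) ^+ 2) @[n --> \oo] --> 0].

Lemma intg_sqrD V W : measurable_fun setT V -> measurable_fun setT W ->
  intg (fun x => V x ^+ 2) -> intg (fun x => W x ^+ 2) ->
  intg (fun x => (V x + W x) ^+ 2).
Proof.
move=> mV mW iV iW; apply: (intg_le _ (intgZ 2 (intgD iV iW))).
  by apply: measurable_funX; exact: measurable_funD.
move=> x; rewrite ger0_norm ?sqr_ge0//.
by have := sqr_ge0 (V x - W x); nra.
Qed.

(** A single finite norm, at [n0], puts [V] in $L^2$; then all the differences are square
    integrable, including the early ones. *)
Lemma L2_cvg_l2norm (V_ : nat -> T -> R) V :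
  (forall n, all_moments P (V_ n)) -> measurable_fun setT V ->
  l2norm P (fun x => V x - V_ n x) @[n --> \oo] --> 0%E -> L2_cvg V_ V.
Proof.
move=> amV_ mV VV.
have mV_ n : measurable_fun setT (V_ n) by have [] := amV_ n.
have mD n : measurable_fun setT (fun x => V x - V_ n x) by exact: measurable_funB.
have [near_i E0] := l2norm_cvg0 mD VV.
have [n0 i0] := filter_ex near_i.
have amN n : intg (fun x => V_ n x ^+ 2) by have [_ h] := amV_ n.
have iV2 : intg (fun x => V x ^+ 2).
  have := intg_sqrD (mD n0) (mV_ n0) i0 (amN n0).
  by apply: eq_integrable => // x _; rewrite /= subrK.
split => // n.
have := intg_sqrD mV (measurableT_comp (@oppr_measurable _ _) (mV_ n)) iV2.
by apply; apply: eq_integrable (amN n) => // x _ /=; rewrite sqrrN.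
Qed.

Lemma L2_cvgD (V_ W_ : nat -> T -> R) V W : L2_cvg V_ V -> L2_cvg W_ W ->
  L2_cvg (fun n x => V_ n x + W_ n x) (fun x => V x + W x).
Proof.
move=> [aV mV iV V0] [aW mW iW W0].
have mV_ n : measurable_fun setT (V_ n) by have [] := aV n.
have mW_ n : measurable_fun setT (W_ n) by have [] := aW n.
have mDV n : measurable_fun setT (fun x => V x - V_ n x) by exact: measurable_funB.
have mDW n : measurable_fun setT (fun x => W x - W_ n x) by exact: measurable_funB.
have e n : (fun x => (V x + W x - (V_ n x + W_ n x)) ^+ 2) =
    (fun x => ((V x - V_ n x) + (W x - W_ n x)) ^+ 2).
  by apply/funext => x; congr (_ ^+ 2); ring.
have iD n := intg_sqrD (mDV n) (mDW n) (iV n) (iW n).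
split.
- by move=> n; exact: all_momentsD.
- exact: measurable_funD.
- by move=> n; rewrite e; exact: iD.
- apply: (@squeeze_cvgr _ _ _ _ (fun=> 0)
    (fun n => 2 * (\int[P]_x ((V x - V_ n x) ^+ 2) + \int[P]_x ((W x - W_ n x) ^+ 2)))).
  + apply: nearW => n; rewrite Rintegral_ge0/=; last by move=> x _; exact: sqr_ge0.
    rewrite -(RintegralD measurableT (iV n) (iW n)).
    rewrite -(RintegralZl 2 measurableT (intgD (iV n) (iW n))) e.
    apply: (le_Rintegral measurableT (iD n) (intgZ 2 (intgD (iV n) (iW n)))) => x _.
    by move: (V x - _) (W x - _) => a b; have := sqr_ge0 (a - b); nra.
  + exact: cvg_cst.
  + rewrite -[X in _ --> X](mulr0 (2 : R)) -[X in _ * X](addr0 (0 : R)).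
    by apply: cvgMr; exact: cvgD.
Qed.

Lemma L2_cvgZ (a : R) (V_ : nat -> T -> R) V : L2_cvg V_ V ->
  L2_cvg (fun n x => a * V_ n x) (fun x => a * V x).
Proof.
move=> [aV mV iV V0].
have e n : (fun x => (a * V x - a * V_ n x) ^+ 2) = (fun x => a ^+ 2 * (V x - V_ n x) ^+ 2).
  by apply/funext => x; rewrite -mulrBr exprMn.
split.
- by move=> n; exact: all_momentsZ.
- exact: measurable_funM.
- by move=> n; rewrite e; exact: intgZ.
- rewrite (_ : (fun n => _) = (fun n => a ^+ 2 * \int[P]_x ((V x - V_ n x) ^+ 2))).
    by rewrite -[X in _ --> X](mulr0 (a ^+ 2)); exact: cvgMr.
  by apply/funext => n; rewrite e (RintegralZl _ measurableT (iV n)).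
Qed.

Lemma L2_cvg_sum (I : Type) (s : seq I) (V_ : I -> nat -> T -> R) (V : I -> T -> R) :
  (forall i, L2_cvg (V_ i) (V i)) ->
  L2_cvg (fun n x => \sum_(i <- s) V_ i n x) (fun x => \sum_(i <- s) V i x).
Proof.
move=> h; elim: s => [|i s IH].
  have e0 : (fun x : T => \sum_(i <- [::]) V i x) = cst 0.
    by apply/funext => x; rewrite big_nil.
  have e n : (fun x : T => \sum_(i <- [::]) V_ i n x) = cst 0.
    by apply/funext => x; rewrite big_nil.
  rewrite e0 (funext e); split => //.
  - by move=> n; exact: all_moments_cst.
  - by move=> n; exact: (intg_cst P ((0 - 0) ^+ 2)).
  - rewrite (_ : (fun n => _) = (fun=> 0)); first exact: cvg_cst.
    by apply/funext => n; rewrite (Rintegral_prob_cst P ((0 - 0) ^+ 2)) subrr expr0n.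
have -> : (fun x => \sum_(j <- i :: s) V j x) = (fun x => V i x + \sum_(j <- s) V j x).
  by apply/funext => x; rewrite big_cons.
have -> : (fun n x => \sum_(j <- i :: s) V_ j n x) =
    (fun n x => V_ i n x + \sum_(j <- s) V_ j n x).
  by apply/funext => n; apply/funext => x; rewrite big_cons.
exact: L2_cvgD.
Qed.

Lemma L2_cvg_gaussian (V_ : nat -> T -> R) V :
  (forall n, gaussian P (V_ n)) -> L2_cvg V_ V -> gaussian P V.
Proof. by move=> gV [_ mV iV V0]; exact: (gaussian_limit gV mV iV V0). Qed.

Lemma L2_cvg_sqr (V_ : nat -> T -> R) V : (forall n, gaussian P (V_ n)) -> L2_cvg V_ V ->
  \int[P]_x (V_ n x ^+ 2) @[n --> \oo] --> \int[P]_x (V x ^+ 2).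
Proof.
by move=> gV [_ mV iV V0]; exact: (@cvg_moment_limit _ _ _ _ _ _ gV mV iV V0 2).
Qed.

Lemma Rintegral_polarize V W : all_moments P V -> all_moments P W ->
  \int[P]_x (V x * W x) = (\int[P]_x ((V x + W x) ^+ 2) -
    \int[P]_x (V x ^+ 2) - \int[P]_x (W x ^+ 2)) / 2.
Proof.
move=> aV aW; have [_ /(_ 2%N) iV] := aV; have [_ /(_ 2%N) iW] := aW.
have iVW := all_moments_intg (all_momentsM aV aW).
under [X in _ = (X - _ - _) / _]eq_Rintegral do rewrite sqrrD -mulr_natl.
rewrite (RintegralD measurableT (intgD iV (intgZ 2 iVW)) iW).
rewrite (RintegralD measurableT iV (intgZ 2 iVW)) (RintegralZl 2 measurableT iVW).
by field.
Qed.

(** Polarisation reduces covariances to second moments, whose convergence is known for Gaussian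
    sequences; this is why the sums are asked to be Gaussian too. *)
Lemma L2_cvg_mul (V_ W_ : nat -> T -> R) V W :
  (forall n, gaussian P (V_ n)) ->
  (forall n, gaussian P (W_ n)) ->
  (forall n, gaussian P (fun x => V_ n x + W_ n x)) ->
  L2_cvg V_ V -> L2_cvg W_ W ->
  \int[P]_x (V_ n x * W_ n x) @[n --> \oo] --> \int[P]_x (V x * W x).
Proof.
move=> gV gW gVW cV cW.
have [aV _] := L2_cvg_gaussian gV cV; have [aW _] := L2_cvg_gaussian gW cW.
rewrite (Rintegral_polarize aV aW).
have e n : \int[P]_x (V_ n x * W_ n x) = (\int[P]_x ((V_ n x + W_ n x) ^+ 2) -
    \int[P]_x (V_ n x ^+ 2) - \int[P]_x (W_ n x ^+ 2)) / 2.
  by apply: Rintegral_polarize; [have [] := gV n|have [] := gW n].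
rewrite (funext e); apply: cvgMl; apply: cvgB; last exact: L2_cvg_sqr.
by apply: cvgB; [apply: L2_cvg_sqr => //; exact: L2_cvgD|exact: L2_cvg_sqr].
Qed.

End L2_limits.

(** * Linear span of the noise *)

Section gaussian_span.
Context {d : measure_display} {T : measurableType d} {R : realType}.
Variables (P : probability T R) (eps : int -> {RV P >-> R}).
Hypothesis heps : iid_std_normal eps.

(** The index list is free of duplicates because [lin_comb_moments] peels off a fresh noise variable
    at each step; sums are rewritten over a common list, padded with zero coefficients. *)
Definition lin_comb (V : T -> R) := exists (s : seq int) (a : int -> R),
  uniq s /\ V = (fun x => \sum_(i <- s) a i * eps i x).

Lemma lin_comb_gaussian V : lin_comb V -> gaussian P V.
Proof.
move=> [s [a [us ->]]].
split.
  apply: all_moments_sum => i; apply: all_momentsZ.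
  exact: (std_normal_all_moments heps).
move=> n; rewrite (lin_comb_moments heps a n us).2 (lin_comb_moments heps a 2 us).2.
by rewrite gauss_momentSS !mulr1 mul1r.
Qed.

Lemma lin_comb_eps i : lin_comb (eps i).
Proof.
exists [:: i], (fun=> 1); split => //.
by apply/funext => x; rewrite big_seq1 mul1r.
Qed.

Lemma lin_combZ (a : R) V : lin_comb V -> lin_comb (fun x => a * V x).
Proof.
move=> [s [b [us ->]]]; exists s, (fun i => a * b i); split => //.
by apply/funext => x; rewrite mulr_sumr; apply: eq_bigr => i _; rewrite mulrA.
Qed.

Lemma lin_combD V W : lin_comb V -> lin_comb W -> lin_comb (fun x => V x + W x).
Proof.
move=> [s [a [us ->]]] [t [b [ut ->]]].
pose st := undup (s ++ t).
have ext (u : seq int) (f : int -> R) x : uniq u -> {subset u <= st} ->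
    \sum_(i <- u) f i * eps i x = \sum_(i <- st) (if i \in u then f i else 0) * eps i x.
  move=> uu sub; rewrite [RHS](bigID (mem u))/= [X in _ = _ + X]big1 ?addr0; last first.
    by move=> i /negbTE ->; rewrite mul0r.
  rewrite [RHS](eq_bigr (fun i => f i * eps i x)); last by move=> i ->.
  rewrite -[RHS]big_filter; apply: perm_big; apply: uniq_perm => //.
    by rewrite filter_uniq// undup_uniq.
  by move=> i; rewrite mem_filter; case: (boolP (i \in u)) => //= /sub.
exists st, (fun i => (if i \in s then a i else 0) + (if i \in t then b i else 0)).
split; first exact: undup_uniq.
apply/funext => x; rewrite (ext s a)// ?(ext t b)//; last 2 first.
- by move=> i it; rewrite mem_undup mem_cat it orbT.
- by move=> i it; rewrite mem_undup mem_cat it.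
by rewrite -big_split/=; apply: eq_bigr => i _; rewrite mulrDl.
Qed.

Lemma lin_comb_sum (I : Type) (s : seq I) (V : I -> T -> R) :
  (forall i, lin_comb (V i)) -> lin_comb (fun x => \sum_(i <- s) V i x).
Proof.
move=> h; elim: s => [|i s IH].
  exists [::], (fun=> 0); split => //.
  by apply/funext => x; rewrite !big_nil.
have -> : (fun x => \sum_(j <- i :: s) V j x) = (fun x => V i x + \sum_(j <- s) V j x).
  by apply/funext => x; rewrite big_cons.
exact: lin_combD.
Qed.

Lemma std_normal_covariance i j : \int[P]_x (eps i x * eps j x) = (i == j)%:R.
Proof.
have [<-|ij] := eqVneq i j.
  by have := std_normal_moment heps i 2; rewrite gauss_momentSS !mulr1.
have am := std_normal_all_moments heps.
rewrite (Rintegral_polarize (am i) (am j)) !(std_normal_moment heps).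
have u : uniq [:: i; j] by rewrite /= inE ij.
have := (lin_comb_moments heps (fun=> 1) 2 u).2.
under eq_Rintegral do rewrite big_cons big_seq1 !mul1r.
move=> ->; rewrite !gauss_momentSS big_cons big_seq1/= expr1n.
by field.
Qed.

End gaussian_span.

(** * Covariances of the FARIMA sequence *)

Lemma sum_nat_delta {R : nzRingType} (F : nat -> R) n k :
  \sum_(0 <= l < n) F l * (l == k)%:R = if (k < n)%N then F k else 0.
Proof.
rewrite big_mkord; case: ltnP => kn.
  rewrite (bigD1 (Ordinal kn))//= eqxx mulr1 big1 ?addr0// => i.
  by rewrite -val_eqE/= => /negbTE ->; rewrite mulr0.
by rewrite big1// => i _; rewrite ltn_eqF ?mulr0// (leq_trans (ltn_ord i)).
Qed.

Lemma gauss_moment_even {R : realType} (v : R) k :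
  gauss_moment v (k * 2) = v ^+ k * gauss_moment 1 (k * 2).
Proof.
elim: k => [|k IH]; first by rewrite !mul1r.
by rewrite mulSn !add2n !gauss_momentSS IH mulr1 exprS; ring.
Qed.

Lemma gauss_moment_even_gt0 {R : realType} k : 0 < gauss_moment (1 : R) (k * 2).
Proof.
elim: k => [|k IH]; first exact: ltr01.
by rewrite mulSn !add2n gauss_momentSS mulr1 mulr_gt0.
Qed.

Section farima_covariance.
Context {d : measure_display} {T : measurableType d} {R : realType}.
Variables (P : probability T R) (r : R) (eps X : int -> {RV P >-> R}).
Hypothesis r01 : 0 < r < 1 / 2.
Hypothesis heps : iid_std_normal eps.
Hypothesis hX : is_farima r eps X.

Local Notation intg f := (P.-integrable [set: T] (EFin \o f)).
Local Notation c := (farima_coef r).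
Local Notation kappa := (farima_var r)^-1.

Let r01' : 0 < r < 1. Proof. by have /andP[-> /= h] := r01; lra. Qed.

Lemma farima_coef_gt0 n : 0 < c n.
Proof. exact: (coef_gt0 r01 (farima_coef0 r01') (fun k => farima_coefS k r01')). Qed.

Lemma farima_var_cvg : series (fun j => c j ^+ 2) n @[n --> \oo] --> farima_var r.
Proof.
apply: nondecreasing_is_cvgn.
  apply/nondecreasing_seqP => n; rewrite /series/= big_nat_recr//= lerDl.
  exact: sqr_ge0.
exists (1%:R * c 0 ^+ 2 / (1 - 2 * r)) => _ [n _ <-].
exact: (coef_sqr_tail r01 (farima_coef0 r01') (fun k => farima_coefS k r01') 0 n).
Qed.

Lemma farima_var_gt0 : 0 < farima_var r.
Proof.
apply: (@lt_le_trans _ _ 1) => //.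
apply: (cvgr_to_ge farima_var_cvg); near=> n.
have n0 : (0 < n)%N by near: n; exact: nbhs_infty_gt.
rewrite /series/= big_ltn// (farima_coef0 r01') expr1n lerDl.
by apply: sumr_ge0 => i _; exact: sqr_ge0.
Unshelve. all: by end_near. Qed.

Definition farima_partial (i : int) (n : nat) (x : T) : R :=
  (Num.sqrt (farima_var r))^-1 * \sum_(0 <= j < n) c j * eps (i - j%:Z) x.

Local Notation S := farima_partial.

Lemma farima_partial_lin_comb i n : lin_comb eps (S i n).
Proof.
apply: lin_combZ; apply: lin_comb_sum => j.
exact/lin_combZ/lin_comb_eps.
Qed.

Let gS i n : gaussian P (S i n).
Proof. exact/(lin_comb_gaussian heps)/farima_partial_lin_comb. Qed.

Lemma farima_L2_cvg i : L2_cvg P (S i) (X i).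
Proof.
apply: L2_cvg_l2norm.
- by move=> n; have [] := gS i n.
- exact: measurable_funPT.
- exact: hX.
Qed.

Lemma farima_gaussian i : gaussian P (X i).
Proof. by apply: L2_cvg_gaussian (farima_L2_cvg i); exact: gS. Qed.

(** Both sums are cut after [n] terms, so that only the pairs with [l = j + m < n] share a noise
    variable; there are [n - m] of them. *)
Lemma farima_partial_covariance (i : int) (m n : nat) :
  \int[P]_x (S i n x * S (i + m%:Z) n x) =
  kappa * \sum_(j < n - m) c j * c (j + m)%N.
Proof.
have am := std_normal_all_moments heps.
have iee a b : intg (fun x => eps a x * eps b x).
  by apply: all_moments_intg; apply: all_momentsM.
pose E j l := (c j * c l) * ((l == j + m)%N%:R : R).
transitivity (kappa * \sum_(0 <= j < n) \sum_(0 <= l < n) E j l).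
  transitivity (\int[P]_x (kappa * \sum_(0 <= j < n) \sum_(0 <= l < n)
      (c j * c l) * (eps (i - j%:Z) x * eps (i + m%:Z - l%:Z) x))).
    apply: eq_Rintegral => x _; rewrite /S mulrACA -expr2 exprVn sqr_sqrtr; last first.
      exact/ltW/farima_var_gt0.
    congr (_ * _); rewrite mulr_suml; apply: eq_bigr => j _.
    by rewrite mulr_sumr; apply: eq_bigr => l _; ring.
  have iin j l : intg (fun x => (c j * c l) * (eps (i - j%:Z) x * eps (i + m%:Z - l%:Z) x)).
    exact: intgZ.
  rewrite (RintegralZl _ measurableT); last first.
    by apply: intg_sum => j; apply: intg_sum => l.
  congr (_ * _); rewrite Rintegral_sum; last by move=> j; apply: intg_sum => l.
  apply: eq_bigr => j _; rewrite Rintegral_sum//; apply: eq_bigr => l _.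
  rewrite (RintegralZl _ measurableT (iee _ _)) (std_normal_covariance heps).
  congr (_ * _); congr (_%:R); congr nat_of_bool.
  rewrite -subr_eq0 (_ : _ - _ = l%:Z - (j%:Z + m%:Z)); last by ring.
  by rewrite subr_eq0 -PoszD eqz_nat.
congr (_ * _); rewrite -(big_mkord xpredT (fun j => c j * c (j + m)%N)).
have e j : \sum_(0 <= l < n) E j l = if (j + m < n)%N then c j * c (j + m)%N else 0.
  exact: (sum_nat_delta (fun l => c j * c l)).
rewrite (eq_bigr _ (fun j _ => e j)).
rewrite (@big_cat_nat _ _ _ (n - m))//= ?leq_subr// [X in _ + X]big_nat_cond.
rewrite [X in _ + X]big1 ?addr0; last first.
  move=> j /andP[/andP[h _] _]; rewrite ifF//.
  by apply/negbTE; rewrite -leqNgt addnC -leq_subLR.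
rewrite big_nat [RHS]big_nat; apply: eq_bigr => j /andP[_ h].
by rewrite ifT// addnC -ltn_subRL.
Qed.

Lemma farima_covariance_cvg (i : int) (m : nat) :
  kappa * \sum_(j < n - m) c j * c (j + m)%N @[n --> \oo] -->
  \int[P]_x (X i x * X (i + m%:Z) x).
Proof.
have := @L2_cvg_mul _ _ _ P (S i) (S (i + m%:Z)) (X i) (X (i + m%:Z)) (gS _) (gS _).
under [X in (_ -> _ -> _ -> X @ _ --> _)]eq_fun do rewrite farima_partial_covariance.
apply; [|exact: farima_L2_cvg|exact: farima_L2_cvg].
by move=> n; apply/(lin_comb_gaussian heps)/lin_combD; exact: farima_partial_lin_comb.
Qed.

Lemma farima_variance i : \int[P]_x (X i x ^+ 2) = 1.
Proof.
have := @farima_covariance_cvg i 0; rewrite addr0 => h1.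
have h2 : kappa * series (fun j => c j ^+ 2) n @[n --> \oo] --> (1 : R).
  rewrite -[X in _ --> X](mulVf (lt0r_neq0 farima_var_gt0)).
  by apply: cvgMr; exact: farima_var_cvg.
have e n : kappa * series (fun j => c j ^+ 2) n = kappa * \sum_(j < n - 0) c j * c (j + 0)%N.
  by rewrite /series/= big_mkord subn0; congr (_ * _); apply: eq_bigr => j _; rewrite addn0 expr2.
rewrite (funext e) in h2.
by rewrite -[RHS](cvg_unique _ h1 h2)//; apply: eq_Rintegral => x _; rewrite expr2.
Qed.

Lemma farima_covariance_le (i : int) (m : nat) :
  0 <= \int[P]_x (X i x * X (i + m%:Z) x) <=
  kappa * (r^-1 + (1 - 2 * r)^-1) * (m.+1%:R * c m ^+ 2).
Proof.
have /andP[rp r2] := r01.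
have k0 : 0 < kappa by rewrite invr_gt0 farima_var_gt0.
have C := farima_coef_gt0.
apply/andP; split.
  apply: (cvgr_to_ge (@farima_covariance_cvg i m)); apply: nearW => n.
  rewrite mulr_ge0 ?(ltW k0)//; apply: sumr_ge0 => j _.
  by rewrite mulr_ge0// ltW.
apply: (cvgr_to_le (@farima_covariance_cvg i m)); apply: nearW => n.
rewrite -mulrA ler_pM2l//.
apply: (le_trans (coef_conv_tail r01 (farima_coef0 r01') (fun k => farima_coefS k r01') m _)).
rewrite [leRHS]mulrA; apply: ler_wpM2r; first exact: sqr_ge0.
rewrite [leRHS](_ : _ = m.+1%:R / r + m.+1%:R / (1 - 2 * r)); last first.
  by rewrite mulrC mulrDr.
rewrite lerD2r.
by rewrite ler_pM2r ?invr_gt0// ler_nat.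
Qed.

Lemma farima_covariance_ge (i : int) (m : nat) : (0 < m)%N ->
  kappa * (m%:R * c m ^+ 2 / (2 * r)) <= \int[P]_x (X i x * X (i + m%:Z) x).
Proof.
move=> m0; have k0 : 0 < kappa by rewrite invr_gt0 farima_var_gt0.
apply: (cvgr_to_ge (@farima_covariance_cvg i m)); near=> n.
rewrite ler_pM2l//.
apply: (coef_conv_ge r01 (farima_coef0 r01') (fun k => farima_coefS k r01')).
(* The bound of [coef_conv_ge] is available once [n] is at least twice [m], which is enough in the
   limit. *)
rewrite m0/= leq_subRL; last by near: n; exact: nbhs_infty_ge.
by near: n; exact: nbhs_infty_ge.
Unshelve. all: by end_near. Qed.

End farima_covariance.

(** * Lower bound for the conditional expectation *)

#[local] Opaque farima_coef farima_var.

Section farima_past.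
Context {d : measure_display} {T : measurableType d} {R : realType}.
Variables (P : probability T R) (r : R) (eps X : int -> {RV P >-> R}).
Hypothesis r01 : 0 < r < 1 / 2.
Hypothesis heps : iid_std_normal eps.
Hypothesis hX : is_farima r eps X.

Local Notation intg f := (P.-integrable [set: T] (EFin \o f)).
Local Notation c := (farima_coef r).
Local Notation kappa := (farima_var r)^-1.
Local Notation K := (r^-1 + (1 - 2 * r)^-1).

Let rp : 0 < r. Proof. by case/andP: r01. Qed.
Let r01' : 0 < r < 1. Proof. by have /andP[-> /= h] := r01; lra. Qed.
Let c0 := farima_coef0 r01'.
Let cS n := farima_coefS n r01'.
Let cp n : 0 < c n. Proof. exact: farima_coef_gt0. Qed.
Let kp : 0 < kappa. Proof. by rewrite invr_gt0 farima_var_gt0. Qed.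
Let Kp : 0 < K.
Proof. by have /andP[h1 h2] := r01; rewrite addr_gt0// invr_gt0//; lra. Qed.

Let amX i : all_moments P (X i).
Proof. by have [] := farima_gaussian heps hX i. Qed.

Definition past_sum (n : nat) (x : T) : R := \sum_(0 <= i < n) X (- i%:Z) x.

Let amU n : all_moments P (past_sum n).
Proof. exact: all_moments_sum. Qed.

Let iXX i j : intg (fun x => X i x * X j x).
Proof. by apply: all_moments_intg; exact: all_momentsM. Qed.

Let RR k := kappa * K * (k.+1%:R * c k ^+ 2).

Let RR0 k : 0 <= RR k.
Proof. by apply/ltW/mulr_gt0; [exact: mulr_gt0|rewrite mulr_gt0// exprn_gt0]. Qed.

Let sum_shift n i : \sum_(0 <= j < n) (if (i <= j)%N then RR (j - i) else 0) <=
  \sum_(0 <= k < n) RR k.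
Proof.
have [ni|ni] := leqP n i.
  rewrite big_nat big1 ?sumr_ge0// => j /andP[_ jn].
  by rewrite ifF// leqNgt (leq_trans jn ni).
rewrite (@big_cat_nat _ _ _ i)//= 1?ltnW// big_nat big1 ?add0r; last first.
  by move=> j /andP[_ ji]; rewrite ifF// leqNgt ji.
rewrite -{1}[i]add0n big_addn.
under eq_bigr => j _ do rewrite leq_addl addnK.
rewrite [leRHS](@big_cat_nat _ _ _ (n - i))//= ?leq_subr// lerDl.
by apply: sumr_ge0 => k _.
Qed.

(** The double sum of covariances is bounded by two triangular sums, both containing the diagonal.
    Each of their [n] rows is at most the sum of the [RR k] for [k < n], which [coef_weighted_sum]
    estimates. *)
Lemma past_sum_variance n : \int[P]_x (past_sum n x ^+ 2) <=
  2 * kappa * K / r ^+ 2 * (n%:R ^+ 2 * (n%:R * c n ^+ 2)).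
Proof.
pose f i j : R := if (i <= j)%N then RR (j - i) else 0.
have cov i j : \int[P]_x (X (- i%:Z) x * X (- j%:Z) x) <= f i j + f j i.
  have f0 a b : 0 <= f a b by rewrite /f; case: ifP.
  wlog ij : i j / (j <= i)%N.
    move=> H; have [ij|/ltnW ij] := leqP j i; first exact: (H i j ij).
    have -> : \int[P]_x (X (- i%:Z) x * X (- j%:Z) x) =
        \int[P]_x (X (- j%:Z) x * X (- i%:Z) x).
      by apply: eq_Rintegral => x _; rewrite mulrC.
    rewrite addrC; exact: (H j i ij).
  have -> : - j%:Z = - i%:Z + (i - j)%N%:Z by rewrite -subzn//; ring.
  have /andP[_ h] := farima_covariance_le r01 heps hX (- i%:Z) (i - j).
  apply: (le_trans h); rewrite /f ij -/(RR _) lerDr; exact: f0.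
have -> : \int[P]_x (past_sum n x ^+ 2) =
    \sum_(0 <= i < n) \sum_(0 <= j < n) \int[P]_x (X (- i%:Z) x * X (- j%:Z) x).
  under eq_Rintegral do rewrite expr2 /past_sum mulr_suml.
  rewrite Rintegral_sum; last first.
    by move=> i; apply/all_moments_intg/all_momentsM => //; exact: amU.
  apply: eq_bigr => i _; under eq_Rintegral do rewrite mulr_sumr.
  by rewrite Rintegral_sum.
apply: (@le_trans _ _ (\sum_(0 <= i < n) \sum_(0 <= j < n) (f i j + f j i))).
  by apply: ler_sum => i _; apply: ler_sum => j _.
under eq_bigr do rewrite big_split/=.
rewrite big_split/= [X in _ + X]exchange_big_nat/=.
apply: (@le_trans _ _ (2 * \sum_(0 <= i < n) \sum_(0 <= k < n) RR k)).
  rewrite mulr_natl mulr2n; apply: lerD; apply: ler_sum => i _; exact: sum_shift.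
rewrite big_const_nat iter_addr_0 subn0 -[_ *+ n]mulr_natl.
rewrite -mulr_sumr big_mkord.
have h := coef_weighted_sum r01 c0 cS n.
have -> : 2 * kappa * K / r ^+ 2 * (n%:R ^+ 2 * (n%:R * c n ^+ 2)) =
    2 * (n%:R * (kappa * K * ((n%:R * c n) ^+ 2 / r ^+ 2))).
  by move: K kappa (r ^+ 2)^-1 (c n) (n%:R : R) => x1 x2 x3 x4 x5; ring.
rewrite ler_wpM2l// ler_wpM2l// ler_wpM2l//.
by rewrite mulr_ge0 ?(ltW kp) ?(ltW Kp).
Qed.

(** All lags $n+i$ lie between $n$ and $2n$, where the coefficients are at least $c_n/2$. The $8$ is
    the $2$ of [coef_conv_ge] times the $4$ from squaring this factor. *)
Lemma past_sum_covariance n : (0 < n)%N ->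
  kappa / (8 * r) * (n%:R * (n%:R * c n ^+ 2)) <=
  \int[P]_x (X n%:Z x * past_sum n x).
Proof.
move=> n0.
under eq_Rintegral do rewrite /past_sum mulr_sumr.
rewrite Rintegral_sum//.
have low i : (0 <= i < n)%N -> kappa / (8 * r) * (n%:R * c n ^+ 2) <=
    \int[P]_x (X n%:Z x * X (- i%:Z) x).
  move=> /andP[_ ni].
  have := @farima_covariance_ge _ _ _ P r eps X r01 heps hX (- i%:Z) (n + i).
  rewrite addn_gt0 n0 => /(_ isT).
  have -> : - i%:Z + (n + i)%N%:Z = n%:Z by rewrite PoszD; ring.
  under eq_Rintegral do rewrite mulrC.
  apply: le_trans.
  have h1 : c n <= 2 * c (n + i)%N.
    apply: (le_trans (coef_mul_le r01 c0 cS n0 (ltn0Sn 1%N))).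
    rewrite (ler_pM2l (ltr0Sn R 1)); apply: (coef_le r01 c0 cS).
    by rewrite mul2n -addnn leq_add2l ltnW.
  have h2 : c n ^+ 2 <= 4 * c (n + i)%N ^+ 2.
    have -> : 4 * c (n + i)%N ^+ 2 = (2 * c (n + i)%N) ^+ 2 by ring.
    apply: lerXn2r; [rewrite nnegrE; exact/ltW|rewrite nnegrE|exact: h1].
    by apply: mulr_ge0; [exact: ler0n|exact/ltW].
  have h3 : n%:R * c n ^+ 2 <= (n + i)%:R * (4 * c (n + i)%N ^+ 2).
    apply: ler_pM; [exact: ler0n|exact: sqr_ge0| |exact: h2].
    by rewrite ler_nat leq_addr.
  have -> : kappa * ((n + i)%:R * c (n + i)%N ^+ 2 / (2 * r)) =
      kappa / (8 * r) * ((n + i)%:R * (4 * c (n + i)%N ^+ 2)).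
    move: kappa ((n + i)%:R : R) (c (n + i)%N) => x1 x2 x3.
    have r0 : r != 0 by rewrite gt_eqF.
    by field; exact: r0.
  by rewrite ler_wpM2l// divr_ge0 ?(ltW kp)// mulr_ge0// ltW.
apply: (@le_trans _ _ (\sum_(0 <= i < n) kappa / (8 * r) * (n%:R * c n ^+ 2))).
  by rewrite big_const_nat iter_addr_0 subn0 -[leRHS]mulr_natl [leRHS]mulrCA.
by rewrite big_nat [leRHS]big_nat; apply: ler_sum.
Qed.

(** Provides the joint hypothesis of the bivariate Stein identity: for each [s] the approximants are
    linear combinations of the noise. *)
Lemma past_sum_gaussian (s : R) n k :
  gaussian P (fun x => s * X k x + past_sum n x).
Proof.
pose S i m := farima_partial r eps i m.
apply: (@L2_cvg_gaussian _ _ _ _ (fun m x => s * S k m x +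
    \sum_(0 <= i < n) S (- i%:Z) m x)).
  move=> m; apply: (lin_comb_gaussian heps); apply: lin_combD.
    by apply: lin_combZ; exact: farima_partial_lin_comb.
  by apply: lin_comb_sum => i; exact: farima_partial_lin_comb.
apply: L2_cvgD; first by apply: L2_cvgZ; exact: farima_L2_cvg.
apply: (L2_cvg_sum (index_iota 0 n)) => i; exact: farima_L2_cvg.
Qed.

Let gU n : gaussian P (past_sum n).
Proof.
have := past_sum_gaussian 0 n 0.
rewrite (_ : (fun x => _) = past_sum n)//.
by apply/funext => x; rewrite mul0r add0r.
Qed.

Lemma past_measurable_sub :
  \bigcup_(i in [set i : int | i <= 0]) preimage_set_system setT (X i) measurable
    `<=` @measurable _ T.
Proof.
move=> A [i _ [B mB <-]]; exact: measurable_funPT.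
Qed.

Lemma past_sum_past n q (B : set R) : measurable B ->
  past X ((fun x => past_sum n x ^+ q) @^-1` B).
Proof.
move=> mB.
pose C := \bigcup_(i in [set i : int | i <= 0]) preimage_set_system setT (X i) measurable.
have mX i : measurable_fun [set: g_sigma_algebraType C] (X (- i%:Z) : g_sigma_algebraType C -> R).
  move=> _ D mD; apply: sub_sigma_algebra.
  exists (- i%:Z) => /=; first by rewrite oppr_le0.
  by exists D.
have mU : measurable_fun [set: g_sigma_algebraType C] (past_sum n : g_sigma_algebraType C -> R).
  by apply: measurable_sum => i.
have := measurable_funX q mU measurableT mB.
by rewrite setTI.
Qed.

Lemma hermite_all_moments q i : all_moments P (hermite q \o X i).
Proof.
rewrite (_ : hermite q \o X i = (fun x => (hermite_poly q).[X i x])); last first.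
  by apply/funext => x /=; rewrite hermiteE.
under eq_fun do rewrite horner_coef.
by apply: all_moments_sum => j; apply: all_momentsZ; exact: all_momentsX.
Qed.

(* Testing the conditional expectation against the [q]-th power of the past sum,
   whose correlation with [X n] is of order [n^(1/2) c_n]. *)
Lemma cond_exp_hermite_sqr_ge q n : (0 < n)%N ->
  let Y := cond_exp P (past X) (hermite q \o X n%:Z) in
  intg (fun x => Y x ^+ 2) ->
  (q`!%:R * (kappa / (8 * r)) ^+ q) ^+ 2 * (n%:R * c n ^+ 2) ^+ q <=
  (2 * kappa * K / r ^+ 2) ^+ q * gauss_moment 1 (q * 2) * \int[P]_x (Y x ^+ 2).
Proof.
move=> n0 Y iY2.
have amZ := hermite_all_moments q n%:Z.
have iZ := all_moments_intg amZ.
have condY : is_cond_exp P (past X) (hermite q \o X n%:Z) Y.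
  exact: (cond_expP past_measurable_sub iZ).
have [mY iY _] := condY.
have mY' := intg_measurable iY.
pose W x := past_sum n x ^+ q.
have amW : all_moments P W by exact: all_momentsX.
have [mW iW] := amW.
have iWY : intg (fun x => W x * Y x) by apply: intgM => //; exact: (iW 2%N).
have iWZ : intg (fun x => W x * (hermite q \o X n%:Z) x).
  by apply: all_moments_intg; exact: all_momentsM.
have EW : \int[P]_x (W x * Y x) = q`!%:R * (\int[P]_x (X n%:Z x * past_sum n x)) ^+ q.
  rewrite (cond_exp_test past_measurable_sub iZ condY _ iWY iWZ); last first.
    by move=> B mB; exact: past_sum_past.
  rewrite -(gaussian_hermite (amX n%:Z) (amU n)).
  - by apply: eq_Rintegral => x _; rewrite /= hermiteE mulrC.
  - by move=> s; exact: past_sum_gaussian.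
  - exact: (farima_variance r01 heps hX).
have EW2 : \int[P]_x (W x ^+ 2) =
    (\int[P]_x (past_sum n x ^+ 2)) ^+ q * gauss_moment 1 (q * 2).
  under eq_Rintegral do rewrite /W -exprM.
  by have [_ ->] := gU n; rewrite gauss_moment_even.
have := cauchy_schwarz mW mY' (iW 2%N) iY2; rewrite EW EW2.
set v := \int[P]_x (past_sum n x ^+ 2); set E2 := \int[P]_x (Y x ^+ 2).
set rho := \int[P]_x (X n%:Z x * past_sum n x); set G := gauss_moment 1 (q * 2).
have G0 : 0 < G by exact: gauss_moment_even_gt0.
have E20 : 0 <= E2 by apply: Rintegral_ge0 => x _; exact: sqr_ge0.
have v0 : 0 <= v by apply: Rintegral_ge0 => x _; exact: sqr_ge0.
have := past_sum_variance n; rewrite -/v; set b := 2 * kappa * K / r ^+ 2 => hv.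
have := past_sum_covariance n0; rewrite -/rho; set a := kappa / (8 * r) => hrho h.
have nR : 0 < n%:R :> R by rewrite ltr0n.
set p := n%:R * c n ^+ 2 in hv hrho *.
have p0 : 0 < p by rewrite mulr_gt0// exprn_gt0.
have a0 : 0 <= a by rewrite divr_ge0 ?(ltW kp)// mulr_ge0// ltW.
have b0 : 0 <= b.
  by rewrite divr_ge0 ?sqr_ge0// mulr_ge0 ?(ltW Kp)// mulr_ge0// ltW.
have np0 : 0 < (n%:R ^+ 2 * p) ^+ q by rewrite exprn_gt0// mulr_gt0// exprn_gt0.
(* With $p=nc_n^2$ the variance is at most $bn^2p$ and the covariance at least $anp$; the factor
   $(n^2p)^q$ avoids dividing by the variance, and $(anp)^{2q}=a^{2q}p^q(n^2p)^q$. *)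
rewrite -(ler_pM2r np0).
apply: (@le_trans _ _ ((q`!%:R * rho ^+ q) ^+ 2)); last first.
  apply: (le_trans h).
  have hvq : v ^+ q <= b ^+ q * (n%:R ^+ 2 * p) ^+ q.
    rewrite -exprMn; apply: lerXn2r; [by rewrite nnegrE|rewrite nnegrE|exact: hv].
    exact: le_trans v0 hv.
  have -> : b ^+ q * G * E2 * (n%:R ^+ 2 * p) ^+ q =
      b ^+ q * (n%:R ^+ 2 * p) ^+ q * (G * E2) by ring.
  rewrite -mulrA; apply: ler_wpM2r; [by rewrite mulr_ge0// ltW|exact: hvq].
have hr : (a * (n%:R * p)) ^+ q <= rho ^+ q.
  have h0 : 0 <= a * (n%:R * p) by rewrite mulr_ge0// mulr_ge0// ltW.
  apply: lerXn2r; [by rewrite nnegrE|rewrite nnegrE|exact: hrho].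
  exact: le_trans h0 hrho.
have -> : (q`!%:R * a ^+ q) ^+ 2 * p ^+ q * (n%:R ^+ 2 * p) ^+ q =
    (q`!%:R * (a * (n%:R * p)) ^+ q) ^+ 2.
  by rewrite !exprMn; ring.
have ge0 : 0 <= (a * (n%:R * p)) ^+ q.
  by rewrite exprn_ge0// mulr_ge0// mulr_ge0// ltW.
apply: lerXn2r.
- by rewrite nnegrE mulr_ge0.
- by rewrite nnegrE mulr_ge0// (le_trans ge0).
- by rewrite ler_wpM2l.
Qed.

End farima_past.

(** * Summability *)

Section summability.
Context {R : realType}.

Lemma nneseries_harmonic_minorant (u : nat -> \bar R) (g : R) : 0 < g ->
  (forall l, (0 < l)%N -> ((g / l%:R)%:E <= u l)%E) ->
  (\sum_(1 <= l <oo) u l = +oo)%E.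
Proof.
move=> g0 gu.
have u0 l : (1 <= l)%N -> xpredT l -> (0 <= u l)%E.
  by move=> l1 _; rewrite (le_trans _ (gu _ l1))// lee_fin divr_ge0// ltW.
apply/eqP; rewrite eq_le leey/= leNgt; apply/negP => Sy.
have S0 : (0 <= \sum_(1 <= l <oo) u l)%E.
  by have := nneseries_lim_ge (m := 1) 1 u0; rewrite big_geq.
have Sfin : (\sum_(1 <= l <oo) u l)%E \is a fin_num by rewrite ge0_fin_numE.
apply: (@dvg_harmonic R); apply: nondecreasing_is_cvgn.
  by apply/nondecreasing_seqP => n; rewrite /series/= big_nat_recr//= lerDl invr_ge0.
exists (fine (\sum_(1 <= l <oo) u l)%E / g) => _ [n _ <-].
rewrite ler_pdivlMr// -lee_fin fineK//.
apply: (le_trans _ (nneseries_lim_ge n.+1 u0)).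
rewrite big_add1 /= mulrC /series/= mulr_sumr -sumEFin; apply: lee_sum => l _.
exact: gu.
Qed.

Lemma powR_exprn (x s : R) n : (x `^ s) ^+ n = x `^ (s * n%:R).
Proof. by rewrite -powR_mulrn ?powR_ge0// powRrM. Qed.

Lemma esum_int_lty (u : int -> \bar R) (b : nat -> \bar R) :
  (forall k, (0 <= u k)%E) ->
  (forall m, (u (Posz m) <= b m)%E) -> (forall m, (u (Negz m) <= b m)%E) ->
  (\esum_(m in [set: nat]) b m < +oo)%E -> (\esum_(k in [set: int]) u k < +oo)%E.
Proof.
move=> u0 up un bs.
rewrite (esumID (range Posz)) => [|k _]; last exact: u0.
rewrite !setTI lte_add_pinfty//.
  rewrite esum_image; last by move=> m n _ _ [].
  by apply: le_lt_trans bs; apply: le_esum => m _; exact: up.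
have -> : ~` range Posz = Negz @` setT.
  apply/seteqP; split => [[n|n]|_ [n _ <-]] //=; first by case; exists n.
    by move=> _; exists n.
  by case.
rewrite esum_image; last by move=> m n _ _ [].
by apply: le_lt_trans bs; apply: le_esum => m _; exact: un.
Qed.

End summability.

Section farima_summability.
Context {disp : measure_display} {T : measurableType disp} {R : realType}.
Variables (P : probability T R) (r : R) (eps X : int -> {RV P >-> R}).
Hypothesis r01 : 0 < r < 1 / 2.
Hypothesis heps : iid_std_normal eps.
Hypothesis hX : is_farima r eps X.

Local Notation c := (farima_coef r).
Local Notation kappa := (farima_var r)^-1.
Local Notation K := (r^-1 + (1 - 2 * r)^-1).

Let rp : 0 < r. Proof. by case/andP: r01. Qed.
Let r01' : 0 < r < 1. Proof. by have /andP[-> /= h] := r01; lra. Qed.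
Let c0 := farima_coef0 r01'.
Let cS n := farima_coefS n r01'.
Let cp n : 0 < c n. Proof. exact: farima_coef_gt0. Qed.
Let kp : 0 < kappa. Proof. by rewrite invr_gt0 farima_var_gt0. Qed.
Let Kp : 0 < K.
Proof. by have /andP[h1 h2] := r01; rewrite addr_gt0// invr_gt0//; lra. Qed.

Lemma farima_coef_sqr_le m :
  m.+1%:R * c m ^+ 2 <= (m%:R + 1) `^ (2 * r - 1) :> R.
Proof.
have m0 : 0 < m%:R + 1 :> R by rewrite natr1 ltr0n.
have hc := coef_powR_ub r01 c0 cS m.
have -> : (m%:R + 1) `^ (2 * r - 1) = (m%:R + 1) * ((m%:R + 1) `^ (r - 1)) ^+ 2 :> R.
  rewrite powR_exprn -[X in _ = X * _](powRr1 (ltW m0)) -powRD; last first.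
    by rewrite (gt_eqF m0) implybT.
  by congr (_ `^ _); ring.
rewrite -natr1 ler_wpM2l//.
apply: lerXn2r; [rewrite nnegrE; exact/ltW|rewrite nnegrE|exact: hc].
exact: powR_ge0.
Qed.

Lemma farima_coef_sqr_ge n : (0 < n)%N ->
  r ^+ 2 * n%:R `^ (2 * r - 1) <= n%:R * c n ^+ 2.
Proof.
move=> n0; have nR : 0 < n%:R :> R by rewrite ltr0n.
have hc := coef_powR_lb r01 c0 cS n0.
have -> : r ^+ 2 * n%:R `^ (2 * r - 1) = n%:R * (r * n%:R `^ (r - 1)) ^+ 2 :> R.
  rewrite exprMn mulrCA powR_exprn; congr (_ * _).
  rewrite -[X in _ = X * _](powRr1 (ltW nR)) -powRD; last first.
    by rewrite (gt_eqF nR) implybT.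
  by congr (_ `^ _); ring.
rewrite ler_wpM2l//; apply: lerXn2r; [rewrite nnegrE|rewrite nnegrE; exact/ltW|exact: hc].
by rewrite mulr_ge0 ?powR_ge0// ltW.
Qed.

Lemma farima_autocov_in_lp (q : nat) : 1 < (1 - 2 * r) * q%:R ->
  in_lp q (autocov X).
Proof.
move=> hq; pose a := (1 - 2 * r) * q%:R - 1.
have a0 : 0 < a by rewrite subr_gt0.
pose M := (kappa * K) ^+ q.
have M0 : 0 <= M by rewrite exprn_ge0// mulr_ge0// ltW.
pose b m : R := M * (m%:R + 1) `^ (- a - 1).
have b0 m : 0 <= b m by rewrite mulr_ge0// powR_ge0.
have coefb m : (kappa * K * (m.+1%:R * c m ^+ 2)) ^+ q <= b m.
  rewrite exprMn ler_wpM2l//.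
  have -> : (m%:R + 1) `^ (- a - 1) = ((m%:R + 1) `^ (2 * r - 1)) ^+ q :> R.
    by rewrite powR_exprn; congr (_ `^ _); rewrite /a; ring.
  apply: lerXn2r; [rewrite nnegrE|by rewrite nnegrE powR_ge0|exact: farima_coef_sqr_le].
  by apply: mulr_ge0; [exact: ler0n|exact: sqr_ge0].
have cov_le (i : int) m :
    (`|(\int[P]_x (X i x * X (i + m%:Z) x))%:E| ^+ q <= (b m)%:E)%E.
  have /andP[h1 h2] := farima_covariance_le r01 heps hX i m.
  rewrite abse_EFin ger0_norm// -EFin_expe lee_fin (le_trans _ (coefb m))//.
  by apply: lerXn2r; rewrite ?nnegrE// (le_trans h1).
have autocovE k : autocov X k = (\int[P]_x (X 0 x * X k x))%:E.
  rewrite /autocov unlock fineK//; apply: integrable_fin_num => //.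
  have am i : all_moments P (X i) by have [] := farima_gaussian heps hX i.
  exact: (all_moments_intg (all_momentsM (am _) (am _))).
(* As [Negz m] is $-(m+1)$, its term is bounded by [b m.+1]; monotonicity returns to the index [m]
   asked for by [esum_int_lty]. *)
have bS m : b m.+1 <= b m.
  have m1 k : 0 < k%:R + 1 :> R by rewrite natr1 ltr0n.
  have am k : 0 < (k%:R + 1) `^ (a + 1) :> R by rewrite powR_gt0.
  rewrite ler_wpM2l// -opprD !powRN lef_pV2 ?posrE//.
  apply: ge0_ler_powR; rewrite ?nnegrE ?(ltW (m1 _))//; last by rewrite lerD2r ler_nat.
  by rewrite addr_ge0// ltW.
apply: (@esum_int_lty _ _ (EFin \o b)).
- by move=> k; exact: expe_ge0.
- by move=> m; rewrite autocovE -[Posz m]add0r; exact: cov_le.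
- move=> m; rewrite NegzE autocovE; under eq_Rintegral do rewrite mulrC.
  (* The covariance bounds look forward in time, so the pair is read from its earlier index
     $-(m+1)$. *)
  have -> : (0 : int) = - m.+1%:Z + m.+1%:Z by rewrite addNr.
  by apply: (le_trans (cov_le _ _)); rewrite lee_fin.
apply: (@le_lt_trans _ _ (M * (1 + a^-1))%:E); last exact: ltry.
rewrite -nneseries_esumT; last by move=> n; rewrite lee_fin.
apply: lime_le; first by apply: is_cvg_nneseries => n _ _; rewrite lee_fin.
apply: nearW => n; rewrite sumEFin lee_fin big_mkord -mulr_sumr ler_wpM2l//.
exact: sum_powR_le.
Qed.

(** Squared, the claim rests on $(lc_l^2)^q\ge r^{2q}l^{-(1-2r)q}\ge r^{2q}l^{-2}$, hence the
    condition on the exponent. The constant is $r^q$ times the square root of the quotient of the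
    constants in [cond_exp_hermite_sqr_ge]. *)
Lemma farima_cond_exp_hermite_l2norm (q : nat) : (1 - 2 * r) * q%:R <= 2 ->
  exists2 g : R, 0 < g & forall l, (0 < l)%N ->
    ((g / l%:R)%:E <= l2norm P (cond_exp P (past X) (hermite q \o X l%:Z)))%E.
Proof.
move=> hq.
pose A := (q`!%:R * (kappa / (8 * r)) ^+ q) ^+ 2.
pose B := (2 * kappa * K / r ^+ 2) ^+ q * gauss_moment 1 (q * 2).
have A0 : 0 < A.
  by rewrite exprn_gt0// mulr_gt0 ?ltr0n ?fact_gt0// exprn_gt0// divr_gt0// mulr_gt0.
have B0 : 0 < B.
  rewrite mulr_gt0 ?gauss_moment_even_gt0// exprn_gt0// divr_gt0 ?exprn_gt0//.
  by rewrite mulr_gt0// mulr_gt0.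
have rq : 0 < (r ^+ 2) ^+ q by rewrite !exprn_gt0.
have D0 : 0 < A * (r ^+ 2) ^+ q / B by rewrite divr_gt0// mulr_gt0.
exists (Num.sqrt (A * (r ^+ 2) ^+ q / B)); first by rewrite sqrtr_gt0.
move=> l l0; have lR : 0 < l%:R :> R by rewrite ltr0n.
set Y := cond_exp _ _ _.
have iZ := all_moments_intg (hermite_all_moments heps hX q l%:Z).
have [_ iY _] : is_cond_exp P (past X) (hermite q \o X l%:Z) Y.
  exact: (cond_expP (@past_measurable_sub _ _ _ _ X) iZ).
(* An infinite norm satisfies the bound trivially; a finite one provides the square integrability
   that Cauchy-Schwarz needs. *)
have [Yoo|Yoo] := ltP (l2norm P Y) +oo%E; last by rewrite (le_trans _ Yoo)// leey.
have [iY2 ->] := l2norm_lty (intg_measurable iY) Yoo.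
have h := cond_exp_hermite_sqr_ge r01 heps hX l0 iY2; rewrite -/A -/B -/Y in h.
rewrite lee_fin -[l%:R]ger0_norm ?ler0n// -sqrtr_sqr -sqrtrV ?sqr_ge0//.
rewrite -sqrtrM ?(ltW D0)// ler_wsqrtr//.
rewrite mulrAC ler_pdivrMr// [leRHS]mulrC (le_trans _ h)// -mulrA ler_wpM2l ?(ltW A0)//.
apply: (@le_trans _ _ ((r ^+ 2 * l%:R `^ (2 * r - 1)) ^+ q)).
  rewrite [leRHS]exprMn ler_wpM2l ?(ltW rq)// powR_exprn -powR_mulrn ?(ltW lR)// -powRN.
  by apply: ler_powR; [rewrite ler1n|rewrite -opprB mulNr lerN2].
apply: lerXn2r; [rewrite nnegrE|rewrite nnegrE|exact: farima_coef_sqr_ge].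
  by rewrite mulr_ge0 ?powR_ge0 ?sqr_ge0.
by apply: mulr_ge0; [exact: ler0n|exact: sqr_ge0].
Qed.

End farima_summability.

Theorem propositionC6 (R : realType) (disp : measure_display)
  (T : measurableType disp) (P : probability T R)
  (d : nat) (r : R) (eps X : int -> {RV P >-> R})
  (hd : (2 <= d)%N)
  (hr : 1 / 2 - 1 / d%:R < r < 1 / 2 - 1 / (2 * d%:R))
  (heps : iid_std_normal eps)
  (hX : is_farima r eps X) :
  in_lp d (autocov X) /\
  (~ cond_decay (hermite d) X /\ cond_decay_sum (hermite d) X = +oo%E).
Proof.
have dR : 2 <= d%:R :> R by rewrite ler_nat.
have d0 : 0 < d%:R :> R by lra.
have di0 : 0 < d%:R^-1 :> R by rewrite invr_gt0.
have did : d%:R^-1 * d%:R = 1 :> R by rewrite mulVf// gt_eqF.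
have di2 : d%:R^-1 <= 1 / 2 :> R by nra.
have [hr1 hr2] : 1 / 2 - d%:R^-1 < r /\ r < 1 / 2 - d%:R^-1 / 2.
  case/andP: hr; rewrite [1 / d%:R]div1r [1 / (2 * _)]div1r invfM => -> h.
  by rewrite [d%:R^-1 / 2]mulrC.
(* Positivity of [r] comes from $1/d\le1/2$, that is from $d\ge2$. *)
have r01 : 0 < r < 1 / 2 by apply/andP; split; lra.
(* The upper bound on [r] amounts to $(1-2r)d>1$, the lower one, used for the second claim, to
   $(1-2r)d<2$. *)
split; first by apply: (farima_autocov_in_lp r01 heps hX); nra.
suff h : cond_decay_sum (hermite d) X = +oo%E by rewrite /cond_decay h.
have [|g g0 hg] := @farima_cond_exp_hermite_l2norm _ _ _ P r eps X r01 heps hX d.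
  by nra.
exact: (nneseries_harmonic_minorant g0 hg).
Qed.
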